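(* Let $0<\varepsilon<1$ and $C>0$ be constants. Suppose that $M=(m_{ij})_{1\le i,j\le n}$ is a real $n\times n$ matrix with $s_0(M)\ge n^{-C}$. Then there exist a submatrix $M'$ of $M$ of size $n_1\times n_2$, with $n_1,n_2=n-O_{C,\varepsilon}(n^{1-\varepsilon})$, and a set of $r=O_{C,\varepsilon}(1)$ vectors $\mathbf{g}_1,\dots,\mathbf{g}_r\in\mathbf{R}^{n_1}$ such that $M'$ can be written as $$M'=M''+F,$$ where $F\in\mathcal{F}_{n_1n_2}$, and the columns of $M''$ belong to a GAP of size $n^{O_{C,\varepsilon}(1)}$ generated by $\mathbf{g}_1,\dots,\mathbf{g}_r$.
   Context: $\mathcal{C}_n=\{-1,1\}^n\subset\mathbf{R}^n$. For a real $n\times n$ matrix $M$, $s_0(M):=\mathbf{P}_{\mathbf{x}\in\mathcal{C}_n}(M\mathbf{x}\in\mathcal{C}_n)$, where $\mathbf{x}$ is uniform in $\mathcal{C}_n$. For integers $a,b$, $\mathcal{F}_{ab}$ denotes the collection of all $\{-1,0,1\}$-matrices of size $a\times b$ in which each row contains at most one non-zero entry. A set $Q\subset Z$, where $Z$ is an abelian torsion-free group, is a generalized arithmetic progression (GAP) of rank $r$ if it can be expressed as $Q=\{\mathbf{g}_0+k_1\mathbf{g}_1+\dots+k_r\mathbf{g}_r: K_i\le k_i\le K_i',\ k_i\in\mathbf{Z}\text{ for all }1\le i\le r\}$ for some $\mathbf{g}_0,\dots,\mathbf{g}_r\in Z$ and integers $K_1,\dots,K_r,K_1',\dots,K_r'$.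 The $\mathbf{g}_i$ are its generators, the $K_i, K_i'$ its dimensions. $Q$ is proper if $|Q|=\prod_i(K_i'-K_i+1)$, and symmetric if $\mathbf{g}_0=0$ and $-K_i=K_i'$ for all $i\ge1$. The size of $Q$ is its cardinality $|Q|$. $O_{C,\varepsilon}(\cdot)$ denotes bounds with implied constants depending only on $C$ and $\varepsilon$. *)

(* Defs.v *)
From HB Require Import structures.
From mathcomp Require Import all_boot all_order all_algebra.
From mathcomp Require Import all_classical all_reals all_analysis.
Set Implicit Arguments.
Unset Strict Implicit.
Unset Printing Implicit Defensive.
Import Order.TTheory GRing.Theory Num.Theory.
Local Open Scope classical_set_scope.
Local Open Scope ring_scope.

Definition cube (R : realType) (n : nat) : {pred 'cV[R]_n} :=
  [pred x : 'cV[R]_n | [forall i, (x i 0 == -1) || (x i 0 == 1)]].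
Arguments cube R n : clear implicits.

(* A finite parametrization of [cube R n], used to count its points. It is a
   bijection by [sign_vector_inj] and [cubeP]. *)
Definition sign_vector (R : realType) (n : nat) (b : {ffun 'I_n -> bool}) :
  'cV[R]_n := \col_i (-1) ^+ b i.

Lemma sign_vector_inj (R : realType) (n : nat) :
  injective (@sign_vector R n).
Proof.
move=> b c /matrixP bc; apply/ffunP => i; have := bc i 0; rewrite !mxE;
  exact: signr_inj.
Qed.

Lemma cubeP (R : realType) (n : nat) (x : 'cV[R]_n) :
  reflect (exists b, x = sign_vector R b) (x \in cube R n).
Proof.
apply: (iffP forallP) => [xP|[b ->] i]; last first.
  by rewrite mxE; case: (b i); rewrite ?expr0 ?expr1 eqxx ?orbT.
exists [ffun i => x i 0 == -1]; apply/colP => i; rewrite !mxE ffunE.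
by have := xP i; case: eqP => [->|_ /= /eqP ->]; rewrite ?expr0 ?expr1.
Qed.

(* The probability that M *m x lies in the cube, for x uniform in the cube. *)
Definition s0 (R : realType) (n : nat) (M : 'M[R]_n) : R :=
  #|[set b : {ffun 'I_n -> bool} | M *m sign_vector R b \in cube R n]%SET|%:R
    / #|{ffun 'I_n -> bool}|%:R.

Definition sparse_sign_matrix (R : realType) (a b : nat) (F : 'M[R]_(a, b)) :
    Prop :=
  (forall i j, F i j \in [:: -1; 0; 1]) /\
  (forall i, (#|[set j | F i j != 0%R]%SET| <= 1)%N).

Definition GAP (Z : zmodType) (r : nat) (g0 : Z) (g : 'I_r -> Z)
    (K K' : 'I_r -> int) : set Z :=
  [set z | exists2 k : 'I_r -> int,
     (forall i, K i <= k i <= K' i) & z = g0 + \sum_(i < r) g i *~ k i].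

(* Main.v *)
(** For a set I of rows the collision probability p_I of the columns restricted
to I, that is the probability that a sum of lazy signs times these columns
vanishes, is at least n^(-2C) / 2^|I|. On the other hand a Hoelder inequality
for positive definite functions bounds it by the return probability of walks
that repeat a few columns many times. Let k be a power of 2 close to
n^((1-eps)/3).

Say that a tuple of columns is dissociated on I at level L if it has no
nontrivial relation on I with integer coefficients of size at most L. Choose d
maximal such that some I with |I| <= d admits a dissociated d-tuple avoiding
any given small set of columns; the bound on p_I forces d = O(1). By
maximality, for every row i, all columns outside a small set U_i are, on I and
row i together, short rational combinations of a d-tuple t_i. The levels
decrease fast with d, so coordinates on I are unique, and passing from t_i to
one reference tuple shows that M_ij = l_i(v_j) for j outside U_i and U_(i0),
i0 being the reference row, where l_i is linear and the coordinates v_j in Q^d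
do not depend on i.

Adding columns whose coordinates are not in (1/N)Z^d multiplies N by some q and
the return probability by at most 1/q + 1/k. Hence few columns have to be
dropped before all coordinates share a denominator N = n^O(1), which gives the
GAP.

Each row of the error e_ij = M_ij - l_i(v_j) is supported on the small set U_i.
Greedily pick rows whose error, outside the supports already used, has two
nonzero entries or an entry outside {-1, 0, 1}. Given the value of the GAP
part, each such row is satisfied with probability at most 3/4 conditionally on
the previous ones, so there are only O(log n) of them; dropping their supports
leaves the matrix F. *)

Require Import Defs.
From mathcomp Require Import all_boot all_order all_algebra.
From mathcomp Require Import all_classical all_reals all_analysis.
From mathcomp Require Import zify ring lra.
Import Order.TTheory GRing.Theory Num.Theory.
Set Implicit Arguments.
Unset Strict Implicit.
Unset Printing Implicit Defensive.
Local Open Scope ring_scope.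

(** * Lazy walks *)

Section LazyWalk.
Variables (R : realFieldType) (V : zmodType).
Implicit Types (phi : V -> R) (s a b : seq V) (v z : V).

(** The step has the law of [v] times a difference of two independent uniform bits: 0 with
    probability 1/2, and [v], [-v] with probability 1/4 each. *)
Definition lazy_step v phi z : R := (phi (z - v) + phi z *+ 2 + phi (z + v)) / 4.
Definition lazy_walk s phi : V -> R := foldr lazy_step phi s.

Lemma lazy_walk_cat a b phi :
  lazy_walk (a ++ b) phi = lazy_walk a (lazy_walk b phi).
Proof. by rewrite /lazy_walk foldr_cat. Qed.

Lemma lazy_stepC u v phi :
  lazy_step u (lazy_step v phi) = lazy_step v (lazy_step u phi).
Proof.
apply/funext => z; rewrite /lazy_step.
rewrite (addrAC z (- u) (- v)) (addrAC z (-u) v) (addrAC z u (- v)).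
rewrite (addrAC z u v); ring.
Qed.

Lemma lazy_step_walkC v s phi :
  lazy_step v (lazy_walk s phi) = lazy_walk s (lazy_step v phi).
Proof. by elim: s => //= u s IHs; rewrite lazy_stepC IHs. Qed.

Lemma lazy_walkC a b phi :
  lazy_walk a (lazy_walk b phi) = lazy_walk b (lazy_walk a phi).
Proof. by elim: a => //= v a IHa; rewrite IHa lazy_step_walkC. Qed.

Lemma perm_lazy_walk a b phi : perm_eq a b -> lazy_walk a phi = lazy_walk b phi.
Proof.
elim: a b => [|v a IHa] b; first by move=> /perm_size /esym /size0nil ->.
move=> vab; have vb : v \in b by rewrite -(perm_mem vab) mem_head.
have [b1 [b2 eb]] : exists b1 b2, b = b1 ++ v :: b2.
  by case/splitPr: vb => b1 b2; exists b1, b2.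
move: vab; rewrite {}eb => vab; rewrite lazy_walk_cat /= (IHa (b1 ++ b2)).
  by rewrite lazy_walk_cat lazy_step_walkC.
by rewrite -(perm_cons v) (perm_trans vab)// -cat1s perm_catCA cat1s.
Qed.

(** Finite lists of points with real coefficients allow any [zmodType]. A real quadratic form only
    sees the even part of [phi], hence the separate clause on evenness. *)
Definition posdef phi : Prop :=
  (forall z, phi (- z) = phi z) /\
  (forall L : seq (R * V),
     0 <= \sum_(x <- L) \sum_(y <- L) x.1 * y.1 * phi (x.2 - y.2)).

Definition origin z : R := (z == 0)%:R.

(** After grouping equal points, the form is a sum of squares, one for each distinct point. *)
Lemma posdef_origin : posdef origin.
Proof.
rewrite /origin; split=> [z|L]; first by rewrite oppr_eq0.
pose P := undup [seq x.2 | x <- L].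
rewrite (_ : \sum_(x <- L) _ =
  \sum_(z <- P) (\sum_(x <- L) x.1 * (x.2 == z)%:R) ^+ 2); last first.
  under [RHS]eq_bigr do rewrite expr2 mulr_suml.
  rewrite [RHS]exchange_big/= [LHS]big_seq [RHS]big_seq; apply: eq_bigr => x xL.
  under [RHS]eq_bigr do rewrite mulr_sumr.
  rewrite [RHS]exchange_big/=; apply: eq_bigr => y _.
  rewrite (bigD1_seq x.2) ?undup_uniq ?mem_undup ?map_f//= eqxx mulr1.
  rewrite big1 ?addr0 => [|z zx]; first by rewrite subr_eq0 eq_sym mulrA.
  by rewrite [x.2 == z]eq_sym (negbTE zx) mulr0 mul0r.
by apply: sumr_ge0 => z _; rewrite sqr_ge0.
Qed.

(** Adjoining to each point its translate by [v], with the same coefficient, turns the form of [phi]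
    into four times the form of the step. *)
Lemma posdef_step v phi : posdef phi -> posdef (lazy_step v phi).
Proof.
move=> [even pos]; split=> [z|L].
  rewrite /lazy_step even -opprD even addrC -[- z + v]opprK opprD opprK even.
  by rewrite addrC [RHS]mulrC [LHS]mulrC; congr (_ * _); ring.
pose L' := L ++ [seq (x.1, x.2 + v) | x <- L].
have := pos L'; rewrite /L' big_cat/= big_map/=.
under eq_bigr do rewrite big_cat/= big_map/=.
under [X in _ + X]eq_bigr do rewrite big_cat/= big_map/=.
rewrite -big_split/= => pos'; rewrite -(pmulr_rge0 _ (ltr0Sn R 3)) mulr_sumr.
apply: le_trans pos' _; rewrite le_eqVlt; apply/orP; left; apply/eqP.
apply: eq_bigr => x _; rewrite -!big_split/= mulr_sumr; apply: eq_bigr => y _.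
rewrite /lazy_step.
rewrite (_ : x.2 - (y.2 + v) = x.2 - y.2 - v); last by rewrite opprD addrA.
rewrite (_ : x.2 + v - y.2 = x.2 - y.2 + v); last by rewrite addrAC.
rewrite (_ : x.2 + v - (y.2 + v) = x.2 - y.2); last by rewrite opprD addrACA subrr addr0.
by field.
Qed.

Lemma posdef_walk s phi : posdef phi -> posdef (lazy_walk s phi).
Proof. by move=> ?; elim: s => //= v s; exact: posdef_step. Qed.

Lemma posdef_ge0 phi : posdef phi -> 0 <= phi 0.
Proof.
move=> [_ /(_ [:: (1, 0)])]; rewrite !big_seq1/= subrr !mul1r; exact.
Qed.

Lemma posdef_le phi z : posdef phi -> phi z <= phi 0.
Proof.
move=> [even /(_ [:: (1, z); (-1, 0)])].
rewrite !big_cons !big_nil/= !subrr subr0 sub0r even; lra.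
Qed.

Lemma lazy_step_le phi v z : posdef phi -> lazy_step v phi z <= phi 0.
Proof.
move=> pphi; rewrite /lazy_step.
have := posdef_le (z - v) pphi; have := posdef_le z pphi.
have := posdef_le (z + v) pphi; lra.
Qed.

Lemma lazy_walk_le phi s : posdef phi -> lazy_walk s phi 0 <= phi 0.
Proof.
move=> pphi; elim: s => //= v s; apply: le_trans.
exact/lazy_step_le/posdef_walk.
Qed.

(** Exposes the walk as a symmetric finite measure, so that positive definiteness of [phi] can be
    tested on it. *)
Lemma lazy_walk_repr s : exists W : seq V, exists c : R,
  [/\ forall phi z, lazy_walk s phi z = c * \sum_(w <- W) phi (z - w) &
      forall phi z, \sum_(w <- W) phi (z - w) = \sum_(w <- W) phi (z + w)].
Proof.
elim: s => [|v s [W [c [walkE symW]]]].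
  by exists [:: 0], 1; split=> phi z; rewrite ?big_seq1 ?subr0 ?addr0// mul1r.
exists ([seq w + v | w <- W] ++ W ++ W ++ [seq w - v | w <- W]), (c / 4).
have E phi z : \sum_(w <- [seq w + v | w <- W] ++ W ++ W ++ [seq w - v | w <- W])
     phi (z - w) = \sum_(w <- W) phi (z - v - w) + (\sum_(w <- W) phi (z - w)) *+ 2
    + \sum_(w <- W) phi (z + v - w).
  rewrite !big_cat !big_map/=.
  under eq_bigr do rewrite [_ + v]addrC opprD addrA.
  under [X in _ + (_ + (_ + X))]eq_bigr do rewrite opprB addrA.
  by rewrite mulr2n !addrA.
split=> phi z; rewrite E.
  by rewrite /= /lazy_step !walkE; field.
rewrite !symW !big_cat !big_map/=.
under [X in _ = X + _]eq_bigr do rewrite [_ + v]addrC addrA.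
under [X in _ = _ + (_ + (_ + X))]eq_bigr do rewrite [_ - v]addrC addrA.
by rewrite mulr2n; ring.
Qed.

(* Convolving phi with the symmetric signed measure (walk a) - (walk b) twice
   gives a nonnegative value at 0. *)
Lemma lazy_walk_mix a b phi : posdef phi ->
  lazy_walk a (lazy_walk b phi) 0 <= lazy_walk a (lazy_walk a phi) 0 \/
  lazy_walk a (lazy_walk b phi) 0 <= lazy_walk b (lazy_walk b phi) 0.
Proof.
move=> pphi.
have [Wa [ca [aE symA]]] := lazy_walk_repr a.
have [Wb [cb [bE symB]]] := lazy_walk_repr b.
pose L := [seq (ca, w) | w <- Wa] ++ [seq (- cb, w) | w <- Wb].
have [even /(_ L)] := pphi; rewrite /L big_cat/= !big_map/=.
under eq_bigr do rewrite big_cat/= !big_map/=.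
under [X in _ + X]eq_bigr do rewrite big_cat/= !big_map/=.
have corr s s' (X X' : seq V) c c' :
    (forall phi z, lazy_walk s phi z = c * \sum_(w <- X) phi (z - w)) ->
    (forall phi z, lazy_walk s' phi z = c' * \sum_(w <- X') phi (z - w)) ->
    (forall phi z, \sum_(w <- X) phi (z - w) = \sum_(w <- X) phi (z + w)) ->
    lazy_walk s (lazy_walk s' phi) 0 =
    \sum_(w <- X) \sum_(w' <- X') c * c' * phi (w - w').
  move=> sE s'E sym; rewrite sE sym mulr_sumr; apply: eq_bigr => w _.
  by rewrite s'E mulrA mulr_sumr add0r.
rewrite !big_split/= -(corr _ _ _ _ _ _ aE aE)//.
have -> : \sum_(w <- Wa) \sum_(w' <- Wb) ca * - cb * phi (w - w') =
   - lazy_walk a (lazy_walk b phi) 0.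
  rewrite (corr _ _ _ _ _ _ aE bE)// -sumrN; apply: eq_bigr => w _.
  by rewrite -sumrN; apply: eq_bigr => w' _; rewrite mulrN mulNr.
have -> : \sum_(w <- Wb) \sum_(w' <- Wa) - cb * ca * phi (w - w') =
   - lazy_walk b (lazy_walk a phi) 0.
  rewrite (corr _ _ _ _ _ _ bE aE)// -sumrN; apply: eq_bigr => w _.
  by rewrite -sumrN; apply: eq_bigr => w' _; rewrite !mulNr.
have -> : \sum_(w <- Wb) \sum_(w' <- Wb) - cb * - cb * phi (w - w') =
   lazy_walk b (lazy_walk b phi) 0.
  rewrite (corr _ _ _ _ _ _ bE bE)//; apply: eq_bigr => w _.
  by apply: eq_bigr => w' _; rewrite mulrNN.
rewrite (lazy_walkC b a) => H.
have [le1|lt1] := leP (lazy_walk a (lazy_walk b phi) 0)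
  (lazy_walk a (lazy_walk a phi) 0); [by left | right; lra].
Qed.

(** Dyadic Cauchy-Schwarz: each half of the list is made constant while the walk along the other
    half is absorbed into [phi], which stays positive definite; [lazy_walk_mix] then selects one of
    the two blocks. Hence the powers of 2. *)
Lemma lazy_walk_holder l (Bs : seq (seq V)) phi : posdef phi -> size Bs = (2 ^ l)%N ->
  exists2 B, B \in Bs & lazy_walk (flatten Bs) phi 0 <=
                        lazy_walk (flatten (nseq (2 ^ l) B)) phi 0.
Proof.
elim: l Bs phi => [|l IHl] Bs phi pphi.
  by case: Bs => [|B [|]]//= _; exists B; rewrite ?mem_head// cats0.
move=> szBs; pose B1 := take (2 ^ l) Bs; pose B2 := drop (2 ^ l) Bs.
have BsE : Bs = B1 ++ B2 by rewrite cat_take_drop.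
have sz1 : size B1 = (2 ^ l)%N by rewrite size_takel// szBs expnS; lia.
have sz2 : size B2 = (2 ^ l)%N by rewrite size_drop szBs expnS; lia.
have [X XB1 leX] := IHl B1 _ (posdef_walk (flatten B2) pphi) sz1.
have [Y YB2 leY] := IHl B2 _ (posdef_walk (flatten (nseq (2 ^ l) X)) pphi) sz2.
have dbl Z : flatten (nseq (2 ^ l.+1) Z) =
   flatten (nseq (2 ^ l) Z) ++ flatten (nseq (2 ^ l) Z).
  by rewrite expnS mul2n -addnn nseqD flatten_cat.
have le12 : lazy_walk (flatten Bs) phi 0 <=
    lazy_walk (flatten (nseq (2 ^ l) X)) (lazy_walk (flatten (nseq (2 ^ l) Y)) phi) 0.
  rewrite BsE flatten_cat lazy_walk_cat (le_trans leX)// lazy_walkC.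
  by rewrite (le_trans leY)// lazy_walkC.
have [leXX|leYY] := lazy_walk_mix (flatten (nseq (2 ^ l) X))
  (flatten (nseq (2 ^ l) Y)) pphi.
- exists X; first by rewrite BsE mem_cat XB1.
  by rewrite dbl lazy_walk_cat; exact: le_trans leXX.
- exists Y; first by rewrite BsE mem_cat YB2 orbT.
  by rewrite dbl lazy_walk_cat; exact: le_trans leYY.
Qed.

Lemma lazy_walk_ge0 s phi z : (forall z, 0 <= phi z) -> 0 <= lazy_walk s phi z.
Proof.
move=> phi0; elim: s z => //= v s IHs z.
by rewrite /lazy_step divr_ge0// !addr_ge0// mulrn_wge0.
Qed.

(* A sum of m lazy steps is a centred binomial variable with 2m trials. *)
Lemma lazy_walk_nseq m v phi z : lazy_walk (nseq m v) phi z =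
  \sum_(i < m.*2.+1) 'C(m.*2, i)%:R / 4 ^+ m * phi (z + v *~ (i%:Z - m%:Z)).
Proof.
pose half v phi z : R := (phi z + phi (z + v)) / 2.
have halfE p psi y : iter p (half v) psi y =
    \sum_(i < p.+1) 'C(p, i)%:R / 2 ^+ p * psi (y + v *+ i).
  elim: p psi y => [|p IHp] psi y.
    by rewrite big_ord1 bin0 expr0 divr1 mul1r addr0.
  rewrite iterS /half !IHp.
  rewrite [RHS]big_ord_recl [X in (X + _) / 2]big_ord_recl/= !bin0 !addr0.
  rewrite mulrDl; under [X in _ = _ + X]eq_bigr do rewrite /bump/= add1n binS natrD !mulrDl.
  rewrite big_split/= addrA; congr (_ + _).
    rewrite [X in _ = _ + X]big_ord_recr/= bin_small// !mul0r addr0.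
    rewrite mulrDl mulr_suml; congr (_ + _).
      by rewrite exprS invfM; ring.
    by apply: eq_bigr => i _; rewrite exprS invfM; ring.
  rewrite mulr_suml; apply: eq_bigr => i _.
  by rewrite exprS invfM -addrA -mulrS; ring.
have stepE psi : lazy_step v psi = fun y => half v (half v psi) (y - v).
  apply/funext => y; rewrite /lazy_step /half !subrK.
  by field.
have -> : lazy_walk (nseq m v) phi z = iter m.*2 (half v) phi (z - v *+ m).
  elim: m z => [|m IHm] z; first by rewrite subr0.
  rewrite /= stepE; rewrite (_ : lazy_walk _ _ = fun y => iter m.*2 (half v) phi (y - v *+ m)).
    have -> : z - v *+ m.+1 = z - v - v *+ m by rewrite mulrS opprD addrA.
    by rewrite /= /half !(addrAC _ v (- (v *+ m))).
  by apply/funext.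
rewrite halfE -mul2n exprM -natrX mul2n; apply: eq_bigr => i _.
by congr (_ * phi _); rewrite mulrzBr -!pmulrn -!addrA [v *+ i + _]addrC.
Qed.

End LazyWalk.

(** * Binomial estimates *)

(** The ratio of consecutive central coefficients is [2 (2m+1) / (m+1)], and
    [(2m+1) (2m+3) <= 4 (m+1)^2]. *)
Lemma central_bin_sqr m : (m.*2.+1 * 'C(m.*2, m) ^ 2 <= 16 ^ m)%N.
Proof.
elim: m => [|m IHm] //.
have E : (m.+1 * 'C(m.+1.*2, m.+1) = 2 * m.*2.+1 * 'C(m.*2, m))%N.
  have e1 := mul_bin_diag m.+1.*2 m.
  have e2 := mul_bin_diag m.*2.+1 m.
  have e3 : 'C(m.*2.+1, m) = 'C(m.*2.+1, m.+1).
    by rewrite -bin_sub ?leqW// -?addnn ?leq_addr//; congr 'C(_, _); lia.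
  rewrite /= in e1 e2; rewrite doubleS/= in e1 *.
  rewrite -e1 e3 (_ : m.*2.+2 = 2 * m.+1)%N; last by lia.
  by rewrite -mulnA -e2 mulnA.
rewrite -(leq_pmul2l (ltn0Sn m)) -(leq_pmul2l (ltn0Sn m)).
have -> : (m.+1 * (m.+1 * (m.+1.*2.+1 * 'C(m.+1.*2, m.+1) ^ 2)) =
   m.+1.*2.+1 * (m.+1 * 'C(m.+1.*2, m.+1)) ^ 2)%N by ring.
rewrite E.
have -> : (m.+1.*2.+1 * (2 * m.*2.+1 * 'C(m.*2, m)) ^ 2 =
   4 * m.+1.*2.+1 * m.*2.+1 * (m.*2.+1 * 'C(m.*2, m) ^ 2))%N by ring.
apply: leq_trans (leq_mul (leqnn _) IHm) _.
by rewrite expnS !mulnA leq_mul2r -!muln2; apply/orP; right; nia.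
Qed.

Lemma central_bin_le k : (k * 'C((k ^ 2).*2, k ^ 2) <= 4 ^ (k ^ 2))%N.
Proof.
rewrite -(@leq_exp2r _ _ 2)// expnMn.
have -> : ((4 ^ (k ^ 2)) ^ 2 = 16 ^ (k ^ 2))%N by rewrite -expnM mulnC expnM.
apply: leq_trans (central_bin_sqr _); rewrite leq_mul2r -addnn; lia.
Qed.

Lemma bin_decr m s : ('C(m.*2, m + s.+1) <= 'C(m.*2, m + s))%N.
Proof.
rewrite -(leq_pmul2l (ltn0Sn (m + s))) addnS mul_bin_left leq_mul2r; lia.
Qed.

(** As [f] decreases, a term at a multiple of [q] is at most each of the [q] terms ending there. The
    second summand on the left stands for the incomplete last block and makes the induction
    close. *)
Lemma sum_dvdn_le (f : nat -> nat) q X : (0 < q)%N ->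
  (forall s, f s.+1 <= f s)%N ->
  (q * (\sum_(1 <= s < X.+1 | q %| s) f s) + (X %% q) * f X <=
   \sum_(1 <= s < X.+1) f s)%N.
Proof.
move=> q0 decr; elim: X => [|X IHX]; first by rewrite !big_geq// mod0n muln0.
rewrite big_mkcond big_nat_recr//= -big_mkcond/= [leqRHS]big_nat_recr//=.
have [qX|nqX] := boolP (q %| X.+1)%N.
  have XE : (X %% q).+1 = q.
    have := modnS X q; rewrite qX => _.
    have := ltn_pmod X q0; rewrite leq_eqVlt => /orP[/eqP//|lt].
    move: qX; rewrite /dvdn -addn1 -modnDml addn1 modn_small//.
  rewrite (eqP qX) mul0n addn0 mulnDr.
  have -> : (q * f X.+1 = X %% q * f X.+1 + f X.+1)%N by rewrite -{1}XE mulSn addnC.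
  have := leq_mul (leqnn (X %% q)) (decr X); lia.
rewrite addn0.
have -> : (X.+1 %% q = (X %% q).+1)%N by rewrite modnS (negbTE nqX).
have := decr X; nia.
Qed.

Lemma sum_centered m (F : nat -> nat) :
  (\sum_(i < m.*2.+1) F i =
   F m + \sum_(1 <= s < m.+1) F (m + s) + \sum_(1 <= s < m.+1) F (m - s))%N.
Proof.
rewrite -(big_mkord xpredT) (@big_cat_nat _ _ _ m)//=; last first.
  by rewrite -addnn -addnS leq_addr.
rewrite addnC; congr (_ + _)%N.
  rewrite -{1}[m]add0n big_addn -addnn subSn ?leq_addr// addKn big_ltn// add0n.
  by congr (_ + _)%N; apply: eq_bigr => i _; rewrite addnC.
rewrite big_nat_rev/= add0n [RHS]big_add1/=.
by apply: eq_big_nat => i ilt; congr F; lia.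
Qed.

(** The central term is kept apart; the two tails are mirror images and decrease away from the
    centre, so [sum_dvdn_le] applies to each. *)
Lemma sum_bin_dvd m q : (0 < q)%N ->
  (q * (\sum_(i < m.*2.+1 | (q %| `|i%:Z - m%:Z|)%N) 'C(m.*2, i)) <=
   q * 'C(m.*2, m) + 4 ^ m)%N.
Proof.
move=> q0; rewrite big_mkcond.
rewrite (sum_centered m (fun i => if (q %| `|i%:Z - m%:Z|)%N then 'C(m.*2, i) else 0)%N).
rewrite subrr dvdn0.
have tot : (4 ^ m = 'C(m.*2, m) + \sum_(1 <= s < m.+1) 'C(m.*2, m + s) +
                                  \sum_(1 <= s < m.+1) 'C(m.*2, m - s))%N.
  rewrite -(sum_centered m (fun i => 'C(m.*2, i))) -[4%N]/(2 ^ 2)%N -expnM mul2n.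
  rewrite -[2%N]/(1 + 1)%N expnDn; apply: eq_bigr => i _.
  by rewrite !exp1n !muln1.
pose f s := 'C(m.*2, m + s).
have fN s : (s < m.+1)%N -> 'C(m.*2, m - s) = f s.
  by move=> sm; rewrite -bin_sub -?addnn; [congr 'C(_, _); lia | lia].
have sym : (\sum_(1 <= s < m.+1) 'C(m.*2, m - s) = \sum_(1 <= s < m.+1) f s)%N.
  by apply: eq_big_nat => s /andP[_ sm]; exact: fN.
have e1 : (\sum_(1 <= s < m.+1)
      (if (q %| `|(m + s)%N%:Z - m%:Z|)%N then 'C(m.*2, m + s) else 0) =
      \sum_(1 <= s < m.+1 | q %| s) f s)%N.
  rewrite [RHS]big_mkcond; apply: eq_big_nat => s _.
  by rewrite PoszD addrAC subrr add0r absz_nat.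
have e2 : (\sum_(1 <= s < m.+1)
      (if (q %| `|(m - s)%N%:Z - m%:Z|)%N then 'C(m.*2, m - s) else 0) =
      \sum_(1 <= s < m.+1 | q %| s) f s)%N.
  rewrite [RHS]big_mkcond; apply: eq_big_nat => s /andP[_ sm].
  by rewrite fN// (_ : `|_| = s)%N//; lia.
have := sum_dvdn_le m q0 (bin_decr m); rewrite -/f.
rewrite tot sym e1 e2 -/(f) !mulnDr.
set T := (\sum_(1 <= s < m.+1) f s)%N; set S := (\sum_(_ <= _ < _ | _) _)%N.
lia.
Qed.

(** * Return probabilities of walks that repeat one column *)

Section Factor.
Variables (R : realFieldType) (V : zmodType).
Implicit Types (phi : V -> R).

(** Only displacements divisible by [q] survive, each with a value of at most [phi 0]. Their total
    probability is at most [1/q + 1/k], where [1/k] pays for the central term. *)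
Lemma lazy_walk_nseq_dvd k q (v : V) phi : (0 < k)%N -> (0 < q)%N ->
  posdef phi -> (forall z, 0 <= phi z) ->
  (forall s : int, (`|s| <= k ^ 2)%N -> phi (v *~ s) != 0 -> (q %| `|s|)%N) ->
  lazy_walk (nseq (k ^ 2) v) phi 0 <= (q%:R^-1 + k%:R^-1) * phi 0.
Proof.
move=> k0 q0 pphi phi0 H; set m := (k ^ 2)%N.
rewrite lazy_walk_nseq.
apply: (@le_trans _ _ (\sum_(i < m.*2.+1 | (q %| `|i%:Z - m%:Z|)%N)
    'C(m.*2, i)%:R / 4 ^+ m * phi 0)).
  rewrite [leRHS]big_mkcond; apply: ler_sum => i _; rewrite add0r.
  have c0 : 0 <= 'C(m.*2, i)%:R / 4 ^+ m :> R by rewrite divr_ge0// exprn_ge0.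
  case: ifPn => [_|ndvd]; first exact: ler_wpM2l (posdef_le _ pphi).
  rewrite (_ : phi _ = 0) ?mulr0//; apply: contraNeq ndvd; apply: H.
  have := ltn_ord i; rewrite -/m; lia.
rewrite -mulr_suml ler_wpM2r//.
rewrite -mulr_suml -natr_sum ler_pdivrMr ?exprn_gt0//.
have := sum_bin_dvd m q0; set S := (\sum_(i < _ | _) _)%N => HS.
have := central_bin_le k; rewrite -/m => Hc.
rewrite -(ler_pM2l (x := q%:R * k%:R)) ?mulr_gt0 ?ltr0n//.
rewrite (_ : q%:R * k%:R * ((q%:R^-1 + k%:R^-1) * 4 ^+ m) = (k%:R + q%:R) * 4 ^+ m :> R).
  rewrite -!natrM -natrD -natrX -!natrM ler_nat; nia.
by field; rewrite !pnatr_eq0 -!lt0n k0 q0.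
Qed.

Lemma lazy_walk_nseq_0 k (v : V) phi : (0 < k)%N ->
  posdef phi -> (forall z, 0 <= phi z) ->
  (forall s : int, (`|s| <= k ^ 2)%N -> phi (v *~ s) != 0 -> s = 0) ->
  lazy_walk (nseq (k ^ 2) v) phi 0 <= k%:R^-1 * phi 0.
Proof.
move=> k0 pphi phi0 H; set m := (k ^ 2)%N.
rewrite lazy_walk_nseq.
have mlt : (m < m.*2.+1)%N by rewrite ltnS -addnn leq_addr.
rewrite (bigD1 (Ordinal mlt))//= big1 => [|i im].
  rewrite addr0 subrr mulr0z addr0 ler_wpM2r// ler_pdivrMr ?exprn_gt0//.
  rewrite mulrC ler_pdivlMr ?ltr0n// -natrX -natrM ler_nat mulnC.
  exact: central_bin_le.
apply/eqP; rewrite mulf_eq0; apply/orP; right; apply: contraNT im.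
rewrite add0r => /H E; apply/eqP/val_inj => /=.
have := ltn_ord i; rewrite -/m in E * => ilt.
have /E : (`|i%:Z - m%:Z| <= m)%N by lia.
by lia.
Qed.

Lemma walk_support m (v : V) phi z : lazy_walk (nseq m v) phi z != 0 ->
  exists2 s : int, (`|s| <= m)%N & phi (z + v *~ s) != 0.
Proof.
rewrite lazy_walk_nseq => nz.
have [i] : exists i : 'I_m.*2.+1, phi (z + v *~ (i%:Z - m%:Z)) != 0.
  apply/existsP; apply: contraNT nz; rewrite negb_exists => /forallP E.
  by rewrite big1// => i _; have := E i; rewrite negbK => /eqP->; rewrite mulr0.
by exists (i%:Z - m%:Z) => //; have := ltn_ord i; lia.
Qed.

(** The exponent is such that the loss of return probability pays for the factor [q] in the
    denominator. For [q >= k] the squared sum is at most [1/k], and [q <= k ^ a]; for [4 <= q < k]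
    it is at most [1/q]; for [q] equal to 2 or 3, [(3/4)^4 <= 1/3] suffices. *)
Lemma order_factor k q a : (4 <= k)%N -> (2 <= q <= k ^ a)%N ->
  (q%:R^-1 + k%:R^-1) ^+ (4 + 2 * a) * q%:R <= 1 :> R.
Proof.
move=> k4 /andP[q2 qa].
have k0 : 0 < k%:R :> R by rewrite ltr0n; lia.
have q0 : 0 < q%:R :> R by rewrite ltr0n; lia.
set r := _ + _.
have r0 : 0 <= r by rewrite addr_ge0// invr_ge0 ltW.
have k4' : 4 <= k%:R :> R by rewrite ler_nat.
have ik : k%:R^-1 <= 4^-1 :> R by rewrite lef_pV2 ?posrE.
have iq : q%:R^-1 <= 2^-1 :> R by rewrite lef_pV2 ?posrE// ler_nat.
have r34 : r <= 3 / 4 by rewrite /r; lra.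
rewrite -ler_pdivlMr// div1r.
have [kq|qk] := leqP k q.
  have rk : r <= 2 / k%:R.
    by rewrite /r mulrDl mul1r lerD2r lef_pV2 ?posrE// ler_nat.
  have r2 : r ^+ 2 <= k%:R^-1.
    apply: (@le_trans _ _ ((2 / k%:R) ^+ 2)); first by rewrite lerXn2r ?nnegrE// divr_ge0 ?ltW.
    rewrite expr2 mulrACA -invfM ler_pdivrMr ?mulr_gt0// mulrA mulVf ?gt_eqF// mul1r; lra.
  rewrite (_ : 4 + 2 * a = 2 * (a + 2))%N; last by lia.
  rewrite exprM; apply: (@le_trans _ _ (k%:R^-1 ^+ (a + 2))).
    by rewrite lerXn2r ?nnegrE ?exprn_ge0// invr_ge0 ltW.
  apply: (@le_trans _ _ (k%:R^-1 ^+ a)).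
    apply: ler_wiXn2l; rewrite ?invr_ge0 ?ltW// ?leq_addr//; lra.
  by rewrite exprVn lef_pV2 ?posrE ?exprn_gt0// -natrX ler_nat.
have rq : r <= 2 / q%:R.
  by rewrite /r mulrDl mul1r lerD2l lef_pV2 ?posrE// ler_nat ltnW.
have [q4|q4] := leqP 4 q.
  have q4' : 4 <= q%:R :> R by rewrite ler_nat.
  have r2 : r ^+ 2 <= q%:R^-1.
    apply: (@le_trans _ _ ((2 / q%:R) ^+ 2)); first by rewrite lerXn2r ?nnegrE// divr_ge0 ?ltW.
    rewrite expr2 mulrACA -invfM ler_pdivrMr ?mulr_gt0// mulrA mulVf ?gt_eqF// mul1r; lra.
  apply: le_trans r2; apply: ler_wiXn2l => //; try lra; lia.
apply: (@le_trans _ _ (r ^+ 4)); first by apply: ler_wiXn2l => //; try lra; lia.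
apply: (@le_trans _ _ ((3 / 4) ^+ 4)); first by rewrite lerXn2r ?nnegrE// ?divr_ge0.
apply: (@le_trans _ _ (3^-1)); first by lra.
by rewrite lef_pV2 ?posrE// ler_nat.
Qed.

End Factor.

(** * Energy of the columns *)

Definition flip n (j : 'I_n) (b : {ffun 'I_n -> bool}) : {ffun 'I_n -> bool} :=
  [ffun i => (i == j) (+) b i].

Lemma flipK n (j : 'I_n) : involutive (flip j).
Proof. by move=> b; apply/ffunP => i; rewrite !ffunE addbA addbb addFb. Qed.

Lemma sum_flip (R : nmodType) n (j : 'I_n) (G : {ffun 'I_n -> bool} -> R) :
  \sum_b G b = \sum_b G (flip j b).
Proof. exact: (reindex_inj (inv_inj (flipK j))). Qed.

Lemma flip_same n (j : 'I_n) b : flip j b j = ~~ b j.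
Proof. by rewrite ffunE eqxx. Qed.

Lemma flip_other n (j i : 'I_n) b : i != j -> flip j b i = b i.
Proof. by rewrite ffunE => /negbTE ->. Qed.

Lemma sqr_sum_le (R : realFieldType) (T : finType) (P : {set T}) (a : T -> R) :
  (\sum_(i in P) a i) ^+ 2 <= #|P|%:R * \sum_(i in P) a i ^+ 2.
Proof.
have [->|P0] := eqVneq P finset.set0.
  by rewrite cards0 mul0r big_set0 expr0n.
have k0 : 0 < #|P|%:R :> R by rewrite ltr0n card_gt0.
set S := \sum_(i in P) a i; set k := #|P|%:R.
have : 0 <= \sum_(i in P) (k * a i - S) ^+ 2 by apply: sumr_ge0 => i _; exact: sqr_ge0.
under eq_bigr do rewrite sqrrB.
rewrite big_split/= sumrB/= sumr_const -mulr_natl -/k.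
under eq_bigr do rewrite exprMn.
rewrite -mulr_sumr sumrMnl -mulr_suml -mulr_sumr -/S.
rewrite (_ : _ + _ = k * (k * \sum_(i in P) a i ^+ 2 - S ^+ 2)); last first.
  by rewrite mulr2n expr2; ring.
by rewrite pmulr_rge0// subr_ge0.
Qed.

Section Energy.
Variables (R : realFieldType) (n : nat).
Local Notation B := {ffun 'I_n -> bool}.

(** Averaging over the four choices of the bits of [b] and [c] at [j] is exactly one lazy step along
    [v j]. *)
Lemma sum_pairs_walk (V : zmodType) (v : 'I_n -> V) (r : seq 'I_n)
    (phi : V -> R) (z : V) : uniq r ->
  \sum_(b : B) \sum_(c : B) phi (z + \sum_(j <- r) (v j *+ b j - v j *+ c j)) =
  4 ^+ n * lazy_walk [seq v j | j <- r] phi z.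
Proof.
elim: r z => [|j r IHr] z /=.
  move=> _; under eq_bigr do under eq_bigr do rewrite big_nil addr0.
  rewrite !sumr_const card_ffun card_bool card_ord -mulrnA -expnMn.
  by rewrite -natrX mulr_natl.
move=> /andP[jr ur].
pose rest (b c : B) := \sum_(j <- r) (v j *+ b j - v j *+ c j).
have restl b c : rest (flip j b) c = rest b c.
  rewrite /rest !big_seq; apply: eq_bigr => i ir; rewrite flip_other//.
  by apply: contraNneq jr => <-.
have restr b c : rest b (flip j c) = rest b c.
  rewrite /rest !big_seq; apply: eq_bigr => i ir; rewrite flip_other//.
  by apply: contraNneq jr => <-.
pose G (b c : B) := phi (z + (v j *+ b j - v j *+ c j + rest b c)).
transitivity (\sum_b \sum_c G b c).
  by apply: eq_bigr => b _; apply: eq_bigr => c _; rewrite big_cons.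
have E : \sum_b \sum_c G b c *+ 4 =
    \sum_b \sum_c (phi (z - v j + rest b c) + phi (z + rest b c) *+ 2 +
                   phi (z + v j + rest b c)).
  have e1 : \sum_b \sum_c G b c = \sum_b \sum_c G b (flip j c).
    by apply: eq_bigr => b _; exact: sum_flip.
  have e2 := sum_flip j (fun b => \sum_c G b c).
  have e3 := sum_flip j (fun b => \sum_c G b (flip j c)).
  under eq_bigr do rewrite sumrMnl. rewrite sumrMnl.
  rewrite (_ : _ *+ 4 = \sum_b \sum_c G b c + \sum_b \sum_c G b (flip j c) +
    \sum_b \sum_c G (flip j b) c + \sum_b \sum_c G (flip j b) (flip j c)); last first.
    by rewrite /= in e2 e3; rewrite -e3 -e1 -e2; ring.
  rewrite -!big_split/=; apply: eq_bigr => b _; rewrite -!big_split/=.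
  apply: eq_bigr => c _; rewrite /G restr !restl restr !flip_same.
  by case: (b j); case: (c j); rewrite ?mulr1n ?mulr0n ?subrr ?subr0 ?sub0r ?add0r !addrA;
     ring.
have := E; under eq_bigr do rewrite sumrMnl; rewrite sumrMnl => {}E.
rewrite /lazy_step mulrA; apply: (@mulIf _ 4); first by rewrite pnatr_eq0.
rewrite divfK ?pnatr_eq0// mulr_natr E mulrDr mulrDr mulrnAr -!IHr//.
rewrite -sumrMnl -!big_split/=; apply: eq_bigr => b _.
by rewrite -sumrMnl -!big_split.
Qed.

Variables (p : nat) (M : 'M[R]_(p, n)).

(** Rows outside [I] are zeroed rather than removed, so that all [I] share one ambient group. *)
Definition colr (I : {set 'I_p}) (j : 'I_n) : 'cV[R]_p :=
  \col_i (if i \in I then M i j else 0).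

(** Good sign vectors fall into at most [2 ^ #|I|] classes according to the signs of their images on
    [I]. Cauchy-Schwarz gives many pairs within a class, and each such pair is a return of the walk
    to the origin. *)
Lemma energy_ge (I : {set 'I_p}) (good : {set B}) :
  (forall b i, b \in good -> i \in I ->
     (\sum_j M i j * (-1) ^+ b j == 1) || (\sum_j M i j * (-1) ^+ b j == -1)) ->
  (#|good|%:R / 2 ^+ n) ^+ 2 <=
  2 ^+ #|I| * lazy_walk [seq colr I j | j <- enum 'I_n] (@origin R _) 0.
Proof.
move=> goodP.
pose sg (b : B) := [set i in I | \sum_j M i j * (-1) ^+ b j == 1].
pose N (t : {set 'I_p}) : R := #|[set b in good | sg b == t]|%:R.
have sgI b : sg b \in powerset I by rewrite powersetE; apply/fintype.subsetP => i; rewrite inE => /andP[].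
have totN : #|good|%:R = \sum_(t in powerset I) N t.
  rewrite -sum1_card (partition_big sg (mem (powerset I)))//= natr_sum.
  apply: eq_bigr => t _; rewrite /N -sum1_card; congr _%:R.
  by apply: eq_bigl => b; rewrite inE.
have := sqr_sum_le (powerset I) N; rewrite -totN card_powerset natrX => H.
rewrite expr_div_n ler_pdivrMr; last by rewrite !exprn_gt0.
apply: le_trans H _; rewrite -mulrA ler_wpM2l ?exprn_ge0//.
rewrite mulrC -exprM mulnC exprM (_ : 2 ^+ 2 = 4); last by ring.
rewrite -sum_pairs_walk ?enum_uniq//.
apply: (@le_trans _ _ (\sum_(b in good) \sum_(c in good) (sg b == sg c)%:R)).
  rewrite (partition_big sg (mem (powerset I)))//=.
  apply: ler_sum => t _; rewrite expr2 {1}/N -sum1_card natr_sum mulr_suml.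
  rewrite [leRHS](eq_bigl (mem [set b in good | sg b == t])); last first.
    by move=> b; rewrite !inE.
  apply: ler_sum => b; rewrite inE => /andP[_ /eqP bt].
  rewrite mul1r /N -sum1_card natr_sum big_mkcond [leRHS]big_mkcond.
  apply: ler_sum => c _; rewrite inE bt eq_sym.
  by case: (c \in good) => //=; case: eqP.
rewrite big_mkcond; apply: ler_sum => b _; case: ifPn => bg; last first.
  by apply: sumr_ge0 => c _; rewrite ler0n.
rewrite big_mkcond; apply: ler_sum => c _; case: ifPn => cg; last by rewrite ler0n.
have [sbc|_] := eqVneq (sg b) (sg c); last by rewrite ler0n.
rewrite add0r /origin.
suff -> : \sum_(j <- enum 'I_n) (colr I j *+ b j - colr I j *+ c j) = 0 by rewrite eqxx.
rewrite big_enum/=; apply/colP => i; rewrite summxE mxE.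
have [iI|iI] := boolP (i \in I); last first.
  by rewrite big1// => j _; rewrite !mxE !mulmxnE !mxE (negbTE iI) !mul0rn subrr.
have eq_bc : \sum_j M i j * (-1) ^+ b j = \sum_j M i j * (-1) ^+ c j.
  have := congr1 (fun A : {set _} => i \in A) sbc; rewrite !inE iI/=.
  have := goodP _ _ bg iI; have := goodP _ _ cg iI.
  by case: eqP => [-> _|_ /= /eqP ->]; case: eqP => [-> _|_ /= /eqP ->].
have : \sum_j M i j * (-1) ^+ b j - \sum_j M i j * (-1) ^+ c j = 0 by rewrite eq_bc subrr.
rewrite -sumrB => E; apply: (@mulfI _ (-2)); first by rewrite oppr_eq0 pnatr_eq0.
rewrite mulr0 -[RHS]E mulr_sumr; apply: eq_bigr => j _.
by rewrite !mxE !mulmxnE !mxE iI; case: (b j); case: (c j); rewrite /= ?mulr1n ?mulr0n; ring.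
Qed.

End Energy.

(** * Dissociated tuples *)

Lemma perm_flatten_nseq (T : eqType) m (s : seq T) :
  perm_eq (flatten (nseq m s)) (flatten [seq nseq m x | x <- s]).
Proof.
elim: s => [|x s IHs] /=; first by elim: m.
suff H : perm_eq (flatten (nseq m (x :: s))) (nseq m x ++ flatten (nseq m s)).
  by apply: perm_trans H _; rewrite perm_cat2l.
elim: {IHs} m => //= m IHm; rewrite perm_cons.
apply: (@perm_trans _ (s ++ nseq m x ++ flatten (nseq m s))).
  by rewrite perm_cat2l.
by rewrite perm_catCA.
Qed.

Lemma perm_enum_cat n (s : seq 'I_n) : uniq s ->
  perm_eq (enum 'I_n) (s ++ [seq j <- enum 'I_n | j \notin s]).
Proof.
move=> us; apply: uniq_perm; first exact: enum_uniq.
  rewrite cat_uniq us filter_uniq ?enum_uniq// andbT.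
  by apply/hasPn => j; rewrite mem_filter => /andP[].
move=> j; rewrite mem_enum mem_cat mem_filter mem_enum andbT.
by case: (j \in s).
Qed.

Section Dissociation.
Variables (R : realFieldType) (p n : nat) (M : 'M[R]_(p, n)).
Implicit Types (I : {set 'I_p}) (U : {set 'I_n}).

Definition dissociated I L d (t : {ffun 'I_d -> 'I_n}) : Prop :=
  forall c : 'I_d -> int, (forall s, (`|c s| <= L)%N) ->
    (forall i, i \in I -> \sum_s M i (t s) *~ c s = 0) -> forall s, c s = 0.

Definition robust I L mu d : Prop := forall U, (#|U| <= mu)%N ->
  exists2 t : {ffun 'I_d -> 'I_n}, (forall s, t s \notin U) & dissociated I L t.

Lemma dissociated_inj I L d (t : {ffun 'I_d -> 'I_n}) :
  (0 < L)%N -> dissociated I L t -> injective t.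
Proof.
move=> L0 H s s' ts; apply/eqP/negPn/negP => ss'.
have := H (fun x => (x == s)%:Z - (x == s')%:Z).
move=> /(_ _ _ s) E; have : (s == s)%:Z - (s == s')%:Z = 0.
  apply: E => [x|i _]; first by case: (x == s); case: (x == s').
  rewrite (bigD1 s)//= (bigD1 s')/=; last by rewrite eq_sym.
  rewrite big1 => [|x /andP[/negbTE -> /negbTE ->]]; last by rewrite subr0 mulr0z.
  rewrite !eqxx [s' == s]eq_sym (negbTE ss') subr0 sub0r addr0 ts.
  by rewrite mulr1z mulrN1z subrr.
by rewrite eqxx (negbTE ss').
Qed.

Definition block d (t : {ffun 'I_d -> 'I_n}) := [seq t s | s <- enum 'I_d].

Lemma size_block d (t : {ffun 'I_d -> 'I_n}) : size (block t) = d.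
Proof. by rewrite size_map size_enum_ord. Qed.

(** Greedy choice: robustness is applied with [U] the set of columns already used. *)
Lemma robust_disjoint I L mu d m : (0 < L)%N -> (m * d <= mu)%N ->
  robust I L mu d -> exists ts : seq {ffun 'I_d -> 'I_n},
  [/\ size ts = m, forall t, t \in ts -> dissociated I L t &
      uniq (flatten [seq block t | t <- ts])].
Proof.
move=> L0 + rob; elim: m => [|m IHm] mmu; first by exists [::].
have [ts [sz dts uts]] := IHm (leq_trans (leq_mul (leqnSn m) (leqnn d)) mmu).
set s := flatten _ in uts.
have szs : size s = (m * d)%N.
  rewrite /s -sz; elim: (ts) => //= t ts' IH.
  by rewrite size_cat size_block IH mulSn.
have [|t tU dt] := rob [set j in s].
  rewrite cardsE (card_uniqP uts) szs; apply: leq_trans mmu.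
  by rewrite leq_mul2r leqnSn orbT.
exists (t :: ts); split=> [|x|] /=; first by rewrite sz.
  by rewrite inE => /orP[/eqP->//|/dts].
rewrite cat_uniq uts andbT map_inj_uniq ?enum_uniq/=; last exact: dissociated_inj dt.
apply/hasPn => x xs; apply/mapP => -[y _ xy].
by have := tU y; rewrite -xy inE xs.
Qed.

Lemma colrE I j i : colr M I j i 0 = if i \in I then M i j else 0.
Proof. by rewrite mxE. Qed.

(** Each run of [k ^ 2] equal columns costs a factor [1/k], because a nonzero multiple of one column
    cannot be compensated by the others. *)
Lemma dissociated_walk I L k d (t : {ffun 'I_d -> 'I_n}) :
  (0 < k)%N -> (k ^ 2 <= L)%N -> dissociated I L t ->
  lazy_walk (flatten (nseq (k ^ 2) [seq colr M I j | j <- block t])) (@origin R _) 0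
  <= k%:R^-1 ^+ d.
Proof.
move=> k0 kL dt; rewrite (perm_lazy_walk _ (perm_flatten_nseq _ _)) -map_comp.
rewrite /block -map_comp -[X in _ ^+ X](size_enum_ord d).
pose F (s : 'I_d) := nseq (k ^ 2) (colr M I (t s)).
rewrite (eq_map (g := F))//.
(* The induction also records that reachable points have coefficients of size at most [k ^ 2],
   vanishing at the indices not yet treated; this makes dissociation applicable at the next
   index. *)
suff: lazy_walk (flatten [seq F s | s <- enum 'I_d]) (@origin R _) 0
    <= k%:R^-1 ^+ size (enum 'I_d) /\
  forall z, lazy_walk (flatten [seq F s | s <- enum 'I_d]) (@origin R _) z != 0 ->
   exists c : 'I_d -> int,
    [/\ forall s, (`|c s| <= k ^ 2)%N, forall s, s \notin enum 'I_d -> c s = 0 &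
        z = \sum_s colr M I (t s) *~ c s] by case.
elim: (enum _) (enum_uniq 'I_d) => [|s r IHr] /=.
  split=> [|z]; first by rewrite /origin eqxx expr0.
  rewrite /origin; have [->|_] := eqVneq z 0 => [_|]; last by rewrite eqxx.
  by exists (fun=> 0); split=> //; rewrite big1.
move=> /andP[sr ur]; have [le0 supp] := IHr ur.
have pos := posdef_walk (flatten [seq F s | s <- r]) (posdef_origin R 'cV[R]_p).
split=> [|z]; rewrite lazy_walk_cat.
  apply: le_trans (lazy_walk_nseq_0 _ pos _ _) _ => //.
  - by move=> z; apply: lazy_walk_ge0 => x; rewrite ler0n.
  - move=> x xk /supp[c [ck cr xE]].
    suff /(_ s) : forall s', c s' - (s' == s)%:Z * x = 0.
      by rewrite eqxx mul1r cr// sub0r => /eqP; rewrite oppr_eq0 => /eqP.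
    apply: dt => [s'|i iI].
      case: eqVneq => [->|_]; rewrite ?mul1r ?mul0r ?subr0.
        by rewrite cr// sub0r abszN (leq_trans xk).
      exact: leq_trans (ck s') kL.
    have /colP/(_ i) := xE; rewrite summxE -[colr _ _ _ *~ _]scaler_int mxE colrE iI => E'.
    under eq_bigr do rewrite mulrzBr.
    rewrite sumrB [X in _ - X](bigD1 s)//= [X in _ - (_ + X)]big1.
      rewrite eqxx mul1r addr0; apply/eqP; rewrite subr_eq0; apply/eqP.
      rewrite -mulrzr mulrC E'; apply: eq_bigr => s' _.
      by rewrite -scaler_int mxE colrE iI mulrC mulrzr.
    by move=> s' /negbTE ->; rewrite mul0r mulr0z.
  by rewrite exprS ler_wpM2l// invr_ge0 ler0n.
move=> /walk_support[x xk /supp[c [ck cr zE]]].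
exists (fun s' => if s' == s then - x else c s'); split=> [s'|s'|].
- by case: ifP => _; rewrite ?abszN.
- rewrite inE negb_or => /andP[/negbTE -> ?]; exact: cr.
- rewrite (bigD1 s)//= eqxx mulrNz; apply/eqP; rewrite addrC -subr_eq opprK; apply/eqP.
  rewrite zE (bigD1 s)//= cr// mulr0z add0r; apply: eq_bigr => s' /negbTE ->//.
Qed.

Lemma lazy_walk_cat_le (V : zmodType) (a b : seq V) (phi : V -> R) : posdef phi ->
  lazy_walk (a ++ b) phi 0 <= lazy_walk a phi 0.
Proof.
by move=> pphi; rewrite lazy_walk_cat lazy_walkC; apply/lazy_walk_le/posdef_walk.
Qed.

(** Robustness yields [(2 ^ l) ^ 2] disjoint dissociated tuples. The other columns are dropped, and
    the Hoelder inequality replaces these tuples by copies of a single one. *)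
Lemma robust_energy I L mu d l : ((2 ^ l) ^ 2 <= L)%N -> ((2 ^ l) ^ 2 * d <= mu)%N ->
  robust I L mu d ->
  lazy_walk [seq colr M I j | j <- enum 'I_n] (@origin R _) 0 <= (2 ^ l)%:R^-1 ^+ d.
Proof.
move=> kL kmu rob.
have k20 : (0 < (2 ^ l) ^ 2)%N by rewrite !expn_gt0.
have [ts [sz dts uts]] := robust_disjoint (leq_trans k20 kL) kmu rob.
rewrite (perm_lazy_walk _ (perm_map _ (perm_enum_cat uts))) map_cat.
apply: le_trans (lazy_walk_cat_le _ _ (posdef_origin _ _)) _.
rewrite map_flatten -map_comp.
have [|B] := @lazy_walk_holder R _ (l * 2) [seq [seq colr M I j | j <- block t] | t <- ts]
   _ (posdef_origin _ _).
  by rewrite size_map sz expnM.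
move=> /mapP[t tts ->] le1; apply: le_trans le1 _; rewrite expnM.
by apply: dissociated_walk kL _; rewrite ?expn_gt0//; exact: dts.
Qed.

End Dissociation.

(** * Coordinates with respect to a tuple *)

Lemma absz_leD (x y : int) : (`|(x + y)%R| <= `|x| + `|y|)%N.
Proof. lia. Qed.

Lemma absz_leB (x y : int) : (`|(x - y)%R| <= `|x| + `|y|)%N.
Proof. by rewrite -(abszN y) absz_leD. Qed.

Section Relations.
Variables (R : realFieldType) (p n : nat) (M : 'M[R]_(p, n)).
Implicit Types (I : {set 'I_p}) (U : {set 'I_n}).

Definition extend_tuple d (j : 'I_n) (t : {ffun 'I_d -> 'I_n}) :
    {ffun 'I_d.+1 -> 'I_n} :=
  [ffun s => if unlift ord0 s is Some s' then t s' else j].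

(** The integers [a] and [b] are kept instead of the quotients [b s / a], because dissociation needs
    bounds on their size. *)
Definition related I L d (t : {ffun 'I_d -> 'I_n}) j (a : int) (b : 'I_d -> int) :=
  [/\ a != 0, (`|a| <= L)%N, forall s, (`|b s| <= L)%N &
      forall i, i \in I -> M i j * a%:~R = \sum_s M i (t s) * (b s)%:~R].

Lemma related_sub I I' L d (t : {ffun 'I_d -> 'I_n}) j a b :
  I \subset I' -> related I' L t j a b -> related I L t j a b.
Proof. by move=> /fintype.subsetP II' [? ? ? H]; split=> // i /II'; exact: H. Qed.

(** A relation on the extended tuple must involve [j], since otherwise it would be a nontrivial
    relation on [t]. *)
Lemma relatedP I I' L L' d (t : {ffun 'I_d -> 'I_n}) j :
  I \subset I' -> (L' <= L)%N -> dissociated M I L t ->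
  ~ dissociated M I' L' (extend_tuple j t) ->
  exists a b, related I' L' t j a b.
Proof.
move=> II' LL' dt /existsNP[c /not_implyP[cL /not_implyP[cI /existsNP[s0 /eqP cs0]]]].
pose c' s := c (lift ord0 s).
have cE i : i \in I' -> M i j *~ c ord0 + \sum_s M i (t s) *~ c' s = 0.
  move=> /cI; rewrite big_ord_recl !ffunE unlift_none => H; rewrite -[RHS]H.
  by congr (_ + _); apply: eq_bigr => s _; rewrite ffunE liftK.
exists (c ord0), (fun s => - c' s); split=> //.
- apply: contraNneq cs0 => c00.
  have c'0 : forall s, c' s = 0.
    apply: dt => [s|i iI]; first exact: leq_trans (cL _) LL'.
    by have := cE i (fintype.subsetP II' _ iI); rewrite c00 mulr0z add0r.
  by case: (unliftP ord0 s0) => [s ->|->]; rewrite ?c00//; apply/eqP/c'0.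
- by move=> s; rewrite abszN; exact: cL.
- move=> i /cE/eqP; rewrite addr_eq0 -mulrzr => /eqP ->.
  by rewrite -sumrN; apply: eq_bigr => s _; rewrite mulrNz mulrN mulrzr.
Qed.

Definition coords d (a : int) (b : 'I_d -> int) : 'rV[R]_d :=
  \row_s ((b s)%:~R / a%:~R).

Lemma coords_row I L d (t : {ffun 'I_d -> 'I_n}) j a b i : i \in I ->
  related I L t j a b -> M i j = \sum_s coords a b 0 s * M i (t s).
Proof.
move=> iI [a0 _ _ /(_ i iI) E]; apply: (@mulIf _ a%:~R); first by rewrite intr_eq0.
rewrite E mulr_suml; apply: eq_bigr => s _; rewrite mxE mulrAC divfK ?intr_eq0//.
exact: mulrC.
Qed.

(* Relations over a dissociated tuple of much larger level have unique
   coordinates, which therefore compose under a change of tuple. *)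
Lemma coords_comp I L L0 d (t0 t1 : {ffun 'I_d -> 'I_n}) j a b a1 b1
    (A : 'I_d -> int) (B : 'I_d -> 'I_d -> int) :
  (d.+1 * L ^ d.+3 <= L0)%N -> dissociated M I L0 t0 ->
  related I L t0 j a b -> related I L t1 j a1 b1 ->
  (forall s, related I L t0 (t1 s) (A s) (B s)) ->
  coords a b = coords a1 b1 *m \matrix_s coords (A s) (B s).
Proof.
move=> LL0 dt0 [a0 aL bL E] [a10 a1L b1L E1] AB.
have L1 : (0 < L)%N by apply: leq_trans aL; rewrite absz_gt0.
have A0 s : A s != 0 by case: (AB s).
pose P := \prod_s A s; pose P' s := \prod_(x | x != s) A x.
have PE s : P = A s * P' s by rewrite /P (bigD1 s).
have leP (Q : pred 'I_d) : (`|(\prod_(x | Q x) A x)%R| <= L ^ d)%N.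
  apply: (@leq_trans (\prod_(x | Q x) L)%N).
    elim/big_rec2: _ => // x y1 y2 _ le12; rewrite abszM leq_mul//.
    by case: (AB x).
  rewrite prod_nat_const leq_pexp2l//; apply: leq_trans (max_card _) _.
  by rewrite card_ord.
(* The difference of the two expansions of column [j], cleared of all denominators. The first term
   is at most [L ^ d.+3] and the second at most [d * L ^ d.+3], whence the lower bound on [L0]. *)
pose c s := P * a1 * b s - a * \sum_s' b1 s' * P' s' * B s' s.
have c0 : forall s, c s = 0.
  apply: dt0 => [s|i iI].
    apply: leq_trans LL0; rewrite /c.
    have h1 : (`|(P * a1 * b s)%R| <= L ^ d.+3)%N.
      apply: (@leq_trans (L ^ d * L * L)%N).
        by rewrite !abszM leq_mul// leq_mul//; exact: leP.
      by rewrite -!expnSr leq_pexp2l.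
    have h2 : (`|(\sum_s' b1 s' * P' s' * B s' s)%R| <= d * L ^ d.+2)%N.
      apply: (@leq_trans (\sum_(s' < d) L ^ d.+2)%N).
        elim/big_rec2: _ => // s' y1 y2 _ le12.
        apply: (@leq_trans (`|(b1 s' * P' s' * B s' s)%R| + `|y2|)%N); first exact: absz_leD.
        rewrite leq_add// !abszM [in leqRHS]expnSr leq_mul//; last by case: (AB s').
        by rewrite expnS leq_mul//; exact: leP.
      by rewrite sum_nat_const card_ord.
    rewrite mulSn; apply: (@leq_trans (`|(P * a1 * b s)%R| + `|(a * \sum_s' b1 s' * P' s' * B s' s)%R|)%N).
      exact: absz_leB.
    by rewrite leq_add// abszM [in leqRHS]expnS mulnCA leq_mul.
  under eq_bigr do rewrite -mulrzr rmorphB/= mulrBr.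
  rewrite sumrB.
  rewrite (_ : \sum_s _ = P%:~R * a1%:~R * (M i j * a%:~R)); last first.
    rewrite (E i iI) mulr_sumr; apply: eq_bigr => s _; rewrite !rmorphM/=; ring.
  rewrite (_ : \sum_s _ = a%:~R * \sum_s' (b1 s')%:~R * ((P' s')%:~R *
       \sum_s M i (t0 s) * (B s' s)%:~R)); last first.
    rewrite mulr_sumr; under [RHS]eq_bigr do rewrite !mulr_sumr.
    rewrite [RHS]exchange_big/=; apply: eq_bigr => s _.
    rewrite rmorphM/= rmorph_sum/= !mulr_sumr; apply: eq_bigr => s' _.
    by rewrite !rmorphM/=; ring.
  rewrite [X in a%:~R * X](_ : _ = P%:~R * (M i j * a1%:~R)); first by ring.
  rewrite (E1 i iI) mulr_sumr; apply: eq_bigr => s' _.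
  by case: (AB s') => _ _ _ /(_ i iI) <-; rewrite (PE s') rmorphM/=; ring.
apply/rowP => s; rewrite !mxE.
have P0 : P%:~R != 0 :> R by rewrite intr_eq0; apply/prodf_neq0 => x _.
have a0' : a%:~R != 0 :> R by rewrite intr_eq0.
have a10' : a1%:~R != 0 :> R by rewrite intr_eq0.
have /eqP := c0 s; rewrite subr_eq0 => /eqP/(congr1 (fun x : int => x%:~R : R)).
rewrite !rmorphM/= rmorph_sum/= => Ec.
have -> : (b s)%:~R = (P%:~R * a1%:~R)^-1 * (P%:~R * a1%:~R * (b s)%:~R) :> R.
  by rewrite mulKf// mulf_neq0.
rewrite Ec mulrCA mulrC mulKf// mulr_sumr; apply: eq_bigr => s' _.
have := A0 s'; rewrite -(intr_eq0 R) => As0; have := PE s'.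
move=> /(congr1 (fun x : int => x%:~R : R)); rewrite !rmorphM/= => PE'.
have P'0 : (P' s')%:~R != 0 :> R by apply: contraNneq P0; rewrite PE' => ->; rewrite mulr0.
rewrite PE' !mxE; field.
by rewrite a10' As0 P'0.
Qed.

(** Expanding column [j] over [t1] on [I] and row [i] together expresses [M i j] through the entries
    of row [i] at [t1]. The change of tuple [P] is invertible, so this is also linear in the
    coordinates over [t0]. *)
Lemma row_functional I I0 I1 L L0 d (t0 t1 : {ffun 'I_d -> 'I_n}) U0 U1
    (a : 'I_n -> int) (b : 'I_n -> 'I_d -> int) i :
  (d.+1 * L ^ d.+3 <= L0)%N ->
  dissociated M I L0 t0 -> dissociated M I L0 t1 ->
  (forall s, t0 s \notin U0) -> (forall s, t1 s \notin U0) -> (forall s, t1 s \notin U1) ->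
  I \subset I0 -> I \subset I1 -> i \in I1 -> (0 < L)%N ->
  (forall t : {ffun 'I_d.+1 -> 'I_n}, (forall s, t s \notin U0) -> ~ dissociated M I0 L t) ->
  (forall t : {ffun 'I_d.+1 -> 'I_n}, (forall s, t s \notin U1) -> ~ dissociated M I1 L t) ->
  (forall j, j \notin U0 -> related I L t0 j (a j) (b j)) ->
  exists l : 'cV[R]_d, forall j, j \notin U0 -> j \notin U1 ->
    M i j = (coords (a j) (b j) *m l) 0 0.
Proof.
move=> LL0 dt0 dt1 t0U0 t1U0 t1U1 II0 II1 iI1 L1 nd0 nd1 relab.
have LL0' : (L <= L0)%N.
  apply: leq_trans LL0; rewrite expnS mulnCA leq_pmulr//.
  by rewrite muln_gt0 expn_gt0 L1.
have ext U (t : {ffun 'I_d -> 'I_n}) j : (forall s, t s \notin U) -> j \notin U ->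
    forall s, extend_tuple j t s \notin U.
  by move=> tU jU s; rewrite ffunE; case: (unlift _ _).
pose P : 'M[R]_d := \matrix_s coords (a (t1 s)) (b (t1 s)).
have relP s : related I L t0 (t1 s) (a (t1 s)) (b (t1 s)) by exact: relab.
(* The rows of [Q] are the coordinates of the entries of [t0] over [t1]; composed with [P] they give
   the trivial expansion of [t0] over itself. *)
have [Q QE] : exists Q : 'M[R]_d, Q *m P = 1%:M.
  have H s : exists q : 'rV[R]_d, q *m P = row s 1%:M.
    have [a1 [b1 rel1]] := relatedP II0 LL0' dt1 (nd0 _ (ext _ _ _ t1U0 (t0U0 s))).
    exists (coords a1 b1).
    have relE : related I L t0 (t0 s) 1 (fun x => (x == s)%:Z).
      split=> // [x|i' _]; first by case: (x == s).
      rewrite (bigD1 s)//= eqxx big1 ?addr0// => x /negbTE ->; exact: mulr0.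
    rewrite -(coords_comp LL0 dt0 relE (related_sub II0 rel1) relP).
    by apply/rowP => x; rewrite !mxE divr1 eq_sym; case: (_ == _).
  have [q qE] := choice H.
  exists (\matrix_s q s); apply/row_matrixP => s; rewrite row_mul rowK; exact: qE.
exists (Q *m \col_s M i (t1 s)) => j jU0 jU1.
have [a1 [b1 rel1]] := relatedP II1 LL0' dt1 (nd1 _ (ext _ _ _ t1U1 jU1)).
rewrite (coords_comp LL0 dt0 (relab j jU0) (related_sub II1 rel1) relP) -/P.
rewrite -mulmxA (mulmxA P) (mulmx1C QE) mul1mx (coords_row iI1 rel1) [RHS]mxE.
by apply: eq_bigr => s _; rewrite [X in _ = _ * X]mxE.
Qed.

End Relations.

(** * A common denominator *)

(** [q] is the order of the vector of the [N * b s / a] modulo integer vectors; it is at most [|a|]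
    because multiplication by [a] clears the denominators. *)
Lemma order_exists d (N : nat) (a : int) (b : 'I_d -> int) : a != 0 ->
  exists q : nat, [/\ (0 < q <= `|a|)%N, forall s, (a %| q%:Z * N%:Z * b s)%Z &
    forall x : int, (forall s, (a %| x * N%:Z * b s)%Z) -> (q %| `|x|)%N].
Proof.
move=> a0; pose Q x := (0 < x)%N && [forall s, (a %| x%:Z * N%:Z * b s)%Z].
have Qa : Q `|a|%N.
  rewrite /Q absz_gt0 a0/=; apply/forallP => s.
  by rewrite -mulrA dvdz_mulr// dvdzE abszE absz_nat.
case: (ex_minnP (ex_intro Q _ Qa)) => q /andP[q0 /forallP Qq] qmin.
exists q; split=> //; first by rewrite q0 qmin.
move=> x xP; rewrite -[q]absz_nat -dvdzE; apply/dvdz_mod0P.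
have q0' : q%:Z != 0 by rewrite -lt0n in q0 *; lia.
have mge := modz_ge0 x q0'; have mlt := ltz_mod x q0'.
apply/eqP/negPn/negP => m0.
have : Q `|(x %% q)%Z|%N.
  rewrite /Q absz_gt0 m0/=; apply/forallP => s; rewrite gez0_abs//.
  rewrite /modz -mulrA mulrBl rpredB// ?mulrA// -mulrA -[(_ * q%:Z) * _]mulrA.
  by apply: dvdz_mull; rewrite mulrA.
by move=> /qmin; lia.
Qed.

Section Denominators.
Variables (R : realFieldType) (p n : nat) (M : 'M[R]_(p, n)).
Variables (I : {set 'I_p}) (L L0 d : nat) (t0 : {ffun 'I_d -> 'I_n}).
Variables (U0 : {set 'I_n}) (a : 'I_n -> int) (b : 'I_n -> 'I_d -> int).
Variables (l alpha G : nat).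
Local Notation k := (2 ^ l)%N.
Local Notation B := (4 + 2 * alpha)%N.
Hypothesis l_ge2 : (2 <= l)%N.
Hypothesis L_le : (L <= k ^ alpha)%N.
Hypothesis L0_ge : (k ^ (B * G) * k ^ 2 * L ^ 2 * (l * B * G).+1 <= L0)%N.
Hypothesis t0_diss : dissociated M I L0 t0.
Hypothesis rel : forall j, j \notin U0 -> related M I L t0 j (a j) (b j).
Hypothesis energy : k%:R^-1 ^+ G <=
  lazy_walk [seq colr M I j | j <- enum 'I_n] (@origin R _) 0.

Let copies (W : seq 'I_n) := flatten [seq nseq (k ^ 2) (colr M I j) | j <- W].
Let remaining (Z : {set 'I_n}) := [seq colr M I j | j <- enum 'I_n & j \notin Z].

(** [W] lists the columns repeated [k ^ 2] times, and [Z] the columns used up or excluded from the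
    start. The fourth clause ties the growth of [N] to the loss of return probability; the last one
    says that the repeated columns only reach points whose coordinates over [t0] have denominator
    [N]. *)
Let state T (N : nat) (Z : {set 'I_n}) (W : seq 'I_n) :=
  [/\ U0 \subset Z /\ (#|Z| <= #|U0| + k ^ 2 * T)%N,
      (2 ^ T <= N)%N,
      k%:R^-1 ^+ G <= lazy_walk (copies W ++ remaining Z) (@origin R _) 0,
      lazy_walk (copies W) (@origin R _) 0 ^+ B * N%:R <= 1 &
      forall z, lazy_walk (copies W) (@origin R _) z != 0 ->
        exists e : 'I_d -> int, (forall s, (`|e s| <= N * T * k ^ 2 * L)%N) /\
          forall i, i \in I -> N%:R * z i 0 = \sum_s (e s)%:~R * M i (t0 s)].

Let k_gt0 : (0 < k)%N. Proof. by rewrite expn_gt0. Qed.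
Let k_ge4 : (4 <= k)%N. Proof. by rewrite -[4%N]/(2 ^ 2)%N leq_exp2l. Qed.

(** The return probability of the copies stays above [k ^ -G], so its [B]-th power bounds [N], and
    [2 ^ T <= N] then bounds [T]. *)
Lemma state_bound T N Z W : state T N Z W ->
  (N <= k ^ (B * G))%N /\ (T <= l * B * G)%N.
Proof.
move=> [_ TN leW WN _].
set E := lazy_walk (copies W) _ 0 in WN.
have kG : k%:R^-1 ^+ G <= E.
  exact: le_trans leW (lazy_walk_cat_le _ _ (posdef_origin _ _)).
have NkG : (N <= k ^ (B * G))%N.
  rewrite -(ler_nat R) mulnC expnM natrX.
  have kG0 : 0 < k%:R^-1 ^+ G :> R by rewrite exprn_gt0// invr_gt0 ltr0n.
  rewrite -(@ler_pM2l _ ((k%:R^-1 ^+ G) ^+ B)); last exact: exprn_gt0.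
  have -> : (k ^ G)%:R = k%:R ^+ G :> R by rewrite natrX.
  rewrite -exprMn -exprMn mulVf ?pnatr_eq0 -?lt0n// !expr1n.
  apply: le_trans WN; rewrite ler_wpM2r// lerXn2r// nnegrE; first exact: ltW.
  exact: le_trans (ltW kG0) kG.
split=> //; rewrite -(@leq_exp2l 2)//; apply: leq_trans TN _.
by rewrite -mulnA expnM.
Qed.

Let bad N (Z : {set 'I_n}) :=
  [set j | (j \notin Z) && ~~ [forall s, (a j %| N%:Z * b j s)%Z]].

(** The Hoelder inequality turns [k ^ 2] bad columns into [k ^ 2] copies of one of them. The order
    [q] of its coordinates modulo [(1/N)Z^d] is at least 2, and the denominator becomes [q * N]. *)
Lemma state_step T N Z W : state T N Z W -> (k ^ 2 <= #|bad N Z|)%N ->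
  exists N' Z' W', state T.+1 N' Z' W'.
Proof.
move=> st bad_ge; have [NG TG] := state_bound st.
case: st => [[U0Z Zle] TN leW WN supp].
have N0 : (0 < N)%N by apply: leq_trans TN; rewrite expn_gt0.
have [Js [uJs JsB szJs]] : exists Js : seq 'I_n,
    [/\ uniq Js, {subset Js <= bad N Z} & size Js = (k ^ 2)%N].
  exists (take (k ^ 2) (enum (bad N Z))); split.
  - by rewrite take_uniq// enum_uniq.
  - by move=> j /mem_take; rewrite mem_enum.
  - by rewrite size_takel// -cardE.
pose Z' := Z :|: [set j in Js].
have JsZ j : j \in Js -> j \notin Z by move=> /JsB; rewrite inE => /andP[].
have rem_perm : perm_eq (remaining Z) ([seq colr M I j | j <- Js] ++ remaining Z').
  rewrite /remaining -map_cat; apply: perm_map; apply: uniq_perm.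
  - by rewrite filter_uniq// enum_uniq.
  - rewrite cat_uniq uJs filter_uniq ?enum_uniq// andbT; apply/hasPn => j.
    by rewrite mem_filter !inE negb_or => /andP[/andP[]].
  - move=> j; have memF (S : {set 'I_n}) : (j \in [seq x <- enum 'I_n | x \notin S]) = (j \notin S).
      by rewrite mem_filter mem_enum andbT.
    rewrite mem_cat !memF !inE negb_or.
    by have := JsZ j; case: (j \in Js); case: (j \in Z) => //= /(_ isT).
have [|B0] := @lazy_walk_holder R _ (l * 2) [seq [:: colr M I j] | j <- Js]
    (lazy_walk (copies W ++ remaining Z') (@origin R _))
    (posdef_walk _ (posdef_origin _ _)).
  by rewrite size_map szJs expnM.
move=> /mapP[j jJs ->].
have -> : flatten [seq [:: colr M I j] | j <- Js] = [seq colr M I j | j <- Js].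
  by elim: (Js) => //= x r ->.
have -> : flatten (nseq (2 ^ (l * 2)) [:: colr M I j]) = nseq (k ^ 2) (colr M I j).
  by rewrite expnM; elim: (k ^ 2)%N => //= x ->.
rewrite -!lazy_walk_cat => hold.
have jU0 : j \notin U0 by apply: contra (JsZ _ jJs); apply: (fintype.subsetP U0Z).
have [aj0 ajL bjL ajE] := rel jU0.
have [q [/andP[q0 qa] qdvd qorder]] := order_exists N (b j) aj0.
have qL : (q <= L)%N by exact: leq_trans ajL.
have q2 : (2 <= q)%N.
  rewrite ltn_neqAle q0 andbT; apply/eqP => q1.
  have := JsB _ jJs; rewrite inE => /andP[_ /negP]; apply; apply/forallP => s.
  by have := qdvd s; rewrite -q1 mul1r.
have pos := posdef_walk (copies W) (posdef_origin R 'cV[R]_p).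
set E := lazy_walk (copies W) (@origin R _) in WN supp pos.
have E0 z : 0 <= E z by apply: lazy_walk_ge0 => x; rewrite ler0n.
(* A multiple of column [j] reached by the old walk has coordinates in [(1/N)Z^d]; as coordinates
   over [t0] are unique, [q] divides the multiplier. *)
have ord (x : int) : (`|x| <= k ^ 2)%N -> E (colr M I j *~ x) != 0 -> (q %| `|x|)%N.
  move=> xk /supp[e [eL eE]]; apply: qorder => s.
  suff : forall s, a j * e s - x * N%:Z * b j s = 0.
    by move=> /(_ s)/eqP; rewrite subr_eq0 => /eqP <-; exact: dvdz_mulr.
  apply: t0_diss => [{}s|i iI].
    apply: leq_trans L0_ge.
    apply: (@leq_trans (L * (N * T * k ^ 2 * L) + k ^ 2 * N * L)%N).
      apply: (@leq_trans (`|(a j * e s)%R| + `|(x * N%:Z * b j s)%R|)%N).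
        exact: absz_leB.
      by rewrite !abszM absz_nat leq_add// ?leq_mul.
    apply: (@leq_trans (N * k ^ 2 * L ^ 2 * T.+1)%N).
      have : (L <= L ^ 2)%N by rewrite expnS expn1 leq_pmulr// (leq_trans _ qL).
      move: (k ^ 2)%N => K; move=> LL2.
      rewrite mulnS addnC leq_add//; last by apply/eq_leq; ring.
      by rewrite [(K * N)%N]mulnC leq_mul.
    by rewrite leq_mul// leq_mul// leq_mul.
  under eq_bigr do rewrite -mulrzr rmorphB/= mulrBr.
  rewrite sumrB [X in X - _](_ : _ = (a j)%:~R * (N%:R * (M i j * x%:~R))); last first.
    have := eE i iI; rewrite -scaler_int mxE colrE iI [M i j * _]mulrC => ->.
    rewrite mulr_sumr; apply: eq_bigr => s' _; rewrite rmorphM/=; ring.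
  rewrite [X in _ - X](_ : _ = x%:~R * N%:R * (M i j * (a j)%:~R)); first by ring.
  by rewrite ajE// mulr_sumr; apply: eq_bigr => s' _; rewrite !rmorphM/=; ring.
have Ele := lazy_walk_nseq_dvd k_gt0 q0 pos E0 ord.
exists (q * N)%N, Z', (j :: W).
have copiesE : copies (j :: W) = nseq (k ^ 2) (colr M I j) ++ copies W by [].
split.
- split; first exact: fintype.subset_trans U0Z (finset.subsetUl _ _).
  apply: leq_trans (leq_card_setU _ _).1 _; rewrite mulnS addnCA addnC.
  by rewrite leq_add// cardsE (card_uniqP uJs) szJs.
- by rewrite expnS leq_mul.
- apply: le_trans leW _; rewrite copiesE -catA.
  apply: le_trans hold; rewrite (lazy_walk_cat (copies W) (remaining Z)) (perm_lazy_walk _ rem_perm).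
  by rewrite !lazy_walk_cat lazy_walkC.
- rewrite copiesE lazy_walk_cat -/E natrM mulrA.
  apply: (@le_trans _ _ (((q%:R^-1 + k%:R^-1) * E 0) ^+ B * q%:R * N%:R)).
    rewrite ler_wpM2r// ler_wpM2r// lerXn2r// nnegrE; first exact: lazy_walk_ge0.
    by rewrite mulr_ge0// addr_ge0// invr_ge0.
  have r0 : 0 <= q%:R^-1 + k%:R^-1 :> R by rewrite addr_ge0// invr_ge0.
  rewrite exprMn [X in X <= _](_ : _ = ((q%:R^-1 + k%:R^-1) ^+ B * q%:R) *
    (E 0 ^+ B * N%:R)); last by ring.
  apply: mulr_ile1; last exact: WN.
  + exact: mulr_ge0 (exprn_ge0 _ r0) (ler0n _ _).
  + exact: mulr_ge0 (exprn_ge0 _ (E0 0)) (ler0n _ _).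
  + by apply: order_factor => //; rewrite q2 (leq_trans qL).
move=> z; rewrite copiesE lazy_walk_cat => /walk_support[x xk /supp[e [eL eE]]].
(* The point is an old one minus [x] times column [j]; both are written over the denominator
   [q * N], and the division is exact by the choice of [q]. *)
exists (fun s => q%:Z * e s - x * ((q%:Z * N%:Z * b j s) %/ a j)%Z); split=> [s|i iI].
  have fle : (`|((q%:Z * N%:Z * b j s) %/ a j)%Z| <= q * N * L)%N.
    rewrite -(leq_pmul2r (_ : 0 < `|a j|)%N) ?absz_gt0// -abszM divzK//.
    rewrite !abszM !absz_nat -[leqLHS]muln1 leq_mul ?absz_gt0//.
    by rewrite leq_mul.
  apply: (@leq_trans (q * (N * T * k ^ 2 * L) + k ^ 2 * (q * N * L))%N); last first.
    by apply/eq_leq; move: (k ^ 2)%N => K; ring.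
  apply: (@leq_trans (`|(q%:Z * e s)%R| + `|(x * ((q%:Z * N%:Z * b j s) %/ a j)%Z)%R|)%N).
    exact: absz_leB.
  by rewrite !abszM absz_nat leq_add// leq_mul.
have := eE i iI; rewrite mxE -scaler_int mxE colrE iI => H.
have {}H : N%:R * z i 0 = \sum_s (e s)%:~R * M i (t0 s) - x%:~R * (N%:R * M i j).
  by rewrite -H; ring.
rewrite natrM -mulrA H mulrBr mulr_sumr.
have -> : q%:R * (x%:~R * (N%:R * M i j)) =
   \sum_s x%:~R * (((q%:Z * N%:Z * b j s) %/ a j)%Z%:~R * M i (t0 s)).
  have a0 : (a j)%:~R != 0 :> R by rewrite intr_eq0.
  apply: (@mulIf _ (a j)%:~R) => //.
  rewrite -!mulrA ajE// !mulr_sumr mulr_suml; apply: eq_bigr => s _.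
  have : ((q%:Z * N%:Z * b j s) %/ a j)%Z * a j = q%:Z * N%:Z * b j s by rewrite divzK.
  move=> /(congr1 (fun x : int => x%:~R : R)); rewrite !rmorphM/= => E1.
  rewrite [RHS](_ : _ = x%:~R * M i (t0 s) *
    (((q%:Z * N%:Z * b j s) %/ a j)%Z%:~R * (a j)%:~R)); last by ring.
  by rewrite E1; ring.
rewrite -sumrB; apply: eq_bigr => s _.
by rewrite rmorphB !rmorphM/= mulrBl !mulrA.
Qed.

(** While at least [k ^ 2] columns are bad, [state_step] applies, which can happen at most
    [l * B * G] times. Once fewer are bad, they join [Z]. *)
Lemma common_denominator : exists (N : nat) (Z : {set 'I_n}),
  [/\ (0 < N <= k ^ (B * G))%N, U0 \subset Z,
      (#|Z| <= #|U0| + k ^ 2 * (l * B * G).+1)%N &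
      forall j s, j \notin Z -> (a j %| N%:Z * b j s)%Z].
Proof.
apply: contrapT => none.
have st T : exists N Z W, state T N Z W.
  elim: T => [|T [N [Z [W st]]]].
    exists 1, U0, [::]; split=> //.
    - by split=> //; rewrite muln0 addn0.
    - apply: le_trans energy _.
      have pe : perm_eq (enum 'I_n) ([seq j <- enum 'I_n | j \notin U0] ++ enum U0).
        rewrite perm_sym perm_catC perm_sym; apply: perm_trans (perm_enum_cat (enum_uniq U0)) _.
        rewrite perm_cat2l (eq_filter (a2 := fun j => j \notin U0))// => j.
        by rewrite mem_enum.
      rewrite (perm_lazy_walk _ (perm_map _ pe)) map_cat.
      exact: lazy_walk_cat_le (posdef_origin _ _).
    - by rewrite /= /origin eqxx expr1n mul1r.
    - move=> z; rewrite /= /origin; have [-> _|_] := eqVneq z 0; last by rewrite eqxx.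
      exists (fun=> 0); split=> // i _; rewrite mxE mulr0 big1// => s _.
      by rewrite mul0r.
  have [small|/(state_step st)//] := ltnP #|bad N Z| (k ^ 2).
  have [NG TG] := state_bound st; case: st => [[U0Z Zle] TN _ _ _].
  case: none; exists N, (Z :|: bad N Z); split.
  - by rewrite NG andbT (leq_trans _ TN)// expn_gt0.
  - exact: fintype.subset_trans U0Z (finset.subsetUl _ _).
  - apply: leq_trans (leq_card_setU _ _).1 _.
    rewrite mulnS addnC addnCA; apply: leq_add; first exact: ltnW.
    by apply: leq_trans Zle _; rewrite leq_add2l leq_mul2l TG orbT.
  - move=> j s; rewrite !inE negb_or => /andP[jZ]; rewrite jZ/= negbK => /forallP; exact.
by have [N [Z [W /state_bound[_]]]] := st (l * B * G).+1; rewrite ltnn.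
Qed.

End Denominators.

(** * Sparsity of the error rows *)

(** If [v] and [v - 2 * al] are both signs, then [al = v], and likewise [be = v]; the fourth value
    is then [-3 * v]. *)
Lemma four_signs (R : realFieldType) (v al be : R) : al != 0 -> be != 0 ->
  (((v == 1) || (v == -1))%R : nat)%:R +
  (((v - 2 * al == 1) || (v - 2 * al == -1))%R : nat)%:R +
  (((v - 2 * be == 1) || (v - 2 * be == -1))%R : nat)%:R +
  (((v - 2 * be - 2 * al == 1) || (v - 2 * be - 2 * al == -1))%R : nat)%:R <= 3 :> R.
Proof.
move=> /eqP al0 /eqP be0.
have : ~~ [&& (v == 1) || (v == -1), (v - 2 * al == 1) || (v - 2 * al == -1),
    (v - 2 * be == 1) || (v - 2 * be == -1) &
    (v - 2 * be - 2 * al == 1) || (v - 2 * be - 2 * al == -1)].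
  apply/negP => /and4P[/orP[]/eqP v1 /orP[]/eqP v2 /orP[]/eqP v3 /orP[]/eqP v4];
    by [apply: al0; lra | apply: be0; lra | lra].
move: (_ || _) (_ || _) (_ || _) (_ || _) => s1 s2 s3 s4.
by rewrite -!natrD (ler_nat R _ 3); case: s1 s2 s3 s4 => [] [] [] [].
Qed.

Section SparseRows.
Variables (R : realFieldType) (p n d : nat) (M : 'M[R]_(p, n)).
Local Notation B := {ffun 'I_n -> bool}.
Variables (good : {set B}) (Z : {set 'I_n}) (U : 'I_p -> {set 'I_n}).
Variables (kap : 'I_n -> 'I_d -> int) (g : 'I_p -> 'I_d -> R) (K mu : nat).
Local Notation x b j := ((-1) ^+ (b : B) j : R).
Local Notation is_sign v := ((v == 1) || (v == -1)).
Hypothesis goodP : forall b i, b \in good -> is_sign (\sum_j M i j * x b j).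
Hypothesis kapK : forall j s, j \notin Z -> (`|kap j s| <= K)%N.
Hypothesis U_le : forall i, (#|U i| <= mu)%N.

Let e i j := M i j - \sum_s (kap j s)%:~R * g i s.

Hypothesis e_supp : forall i j, j \notin Z -> j \notin U i -> e i j = 0.

(** The integer coordinates [y] of the structured part are frozen independently of [b], so that
    flipping a sign outside [Z] acts on row [i] only through its error. *)
Let u (y : 'I_d -> int) i b := \sum_(j in Z) M i j * x b j +
  \sum_s (y s)%:~R * g i s + \sum_(j | j \notin Z) e i j * x b j.

Lemma u_flip y i j b : j \notin Z -> u y i (flip j b) = u y i b - 2 * (e i j * x b j).
Proof.
move=> jZ; rewrite /u.
rewrite (eq_bigr (fun j => M i j * x b j)); last first.
  by move=> j' j'Z; rewrite flip_other//; apply: contraNneq jZ => <-.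
rewrite [in LHS](bigD1 j jZ) [in RHS](bigD1 j jZ)/= flip_same.
rewrite [X in _ + (_ + X) = _](eq_bigr (fun j => e i j * x b j)); last first.
  by move=> j' /andP[_ j'j]; rewrite flip_other.
by case: (b j); rewrite ?expr0 ?expr1 /=; ring.
Qed.

Lemma sign_sq b j : x b j = 1 \/ x b j = -1.
Proof. by case: (b j); [right; rewrite expr1|left]. Qed.

Lemma u_good b i : b \in good ->
  is_sign (u (fun s => \sum_(j | j \notin Z) kap j s * (-1) ^+ b j) i b).
Proof.
move=> bg; suff -> : u (fun s => \sum_(j | j \notin Z) kap j s * (-1) ^+ b j) i b =
    \sum_j M i j * x b j by exact: goodP.
rewrite /u; apply/esym.
rewrite (bigID (mem Z))/= -addrA; congr (_ + _).
rewrite /e; under [X in _ + X]eq_bigr do rewrite mulrBl.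
rewrite sumrB addrC -addrA [X in _ = _ + X](_ : _ = 0) ?addr0// addrC.
apply/eqP; rewrite subr_eq0; apply/eqP.
under eq_bigr do rewrite rmorph_sum/= mulr_suml.
rewrite exchange_big/=; apply: eq_bigr => j _; rewrite mulr_suml.
by apply: eq_bigr => s _; rewrite rmorphM/= rmorphXn/= rmorphN1; ring.
Qed.

Let pass y rows b := all (fun i => is_sign (u y i b)) rows.

Let state T (D : {set 'I_n}) (rows : seq 'I_p) :=
  [/\ Z \subset D, (#|D| <= #|Z| + T * mu)%N,
      forall i j, i \in rows -> j \notin D -> e i j = 0 &
      forall y, \sum_b (pass y rows b)%:R <= (3 / 4) ^+ T * 2 ^+ n :> R].

Let sparse (D : {set 'I_n}) := forall i,
  (forall j, j \notin D -> e i j \in [:: -1; 0; 1]) /\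
  (forall j j', j \notin D -> j' \notin D -> e i j != 0 -> e i j' != 0 -> j = j').

Lemma pass_flip (D : {set 'I_n}) (rows : seq 'I_p) y j b : Z \subset D ->
  (forall i j, i \in rows -> j \notin D -> e i j = 0) -> j \notin D ->
  pass y rows (flip j b) = pass y rows b.
Proof.
move=> ZD eD jD; apply: eq_in_all => i irows.
rewrite u_flip ?eD ?mul0r ?mulr0 ?subr0//.
by apply: contra jD; exact: (fintype.subsetP ZD).
Qed.

Lemma sparse_step T D rows : state T D rows -> ~ sparse D ->
  exists D' rows', state T.+1 D' rows'.
Proof.
move=> [ZD Dle eD cnt] /existsNP[i nsp].
have notZ j : j \notin D -> j \notin Z by apply: contra; exact: (fintype.subsetP ZD).
exists (D :|: U i), (i :: rows); split.
- exact: fintype.subset_trans ZD (finset.subsetUl _ _).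
- apply: leq_trans (leq_card_setU _ _).1 _.
  by rewrite mulSn addnCA addnC leq_add.
- move=> i' j; rewrite !inE negb_or => /orP[/eqP->|i'r] /andP[jD jU].
    by apply: e_supp; rewrite ?notZ.
  exact: eD.
move=> y; set P := pass y rows.
pose Q b := is_sign (u y i b).
suff step : \sum_b (P b && Q b)%:R <= 3 / 4 * \sum_b (P b)%:R :> R.
  apply: (@le_trans _ _ (\sum_b (P b && Q b)%:R)).
    by apply: ler_sum => b _; rewrite /pass/= andbC.
  apply: le_trans step _; rewrite exprS -(mulrA (3 / 4)).
  by apply: ler_wpM2l (cnt y); lra.
have flipE j : j \notin D -> \sum_b (P b && Q b)%:R =
    \sum_b (P b && Q (flip j b))%:R :> R.
  move=> jD; rewrite (sum_flip j); apply: eq_bigr => b _.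
  by rewrite /P (pass_flip _ _ ZD eD jD).
have [eD1|/existsNP[j /not_implyP[jD eij]]] :=
    pselect (forall j, j \notin D -> e i j \in [:: -1; 0; 1]); last first.
  (* Flipping [j] changes the value by [2 * e i j] up to sign. Two signs differ by 0, 2 or -2, so at
     most one of the two vectors passes. *)
  have h b : (P b && Q b)%:R + (P b && Q (flip j b))%:R <= (P b)%:R :> R.
    case: (P b) => /=; last by rewrite addr0.
    rewrite /Q u_flip ?notZ//; case: (boolP (is_sign (u y i b))) => [ub|_]; last first.
      by rewrite add0r ler_nat leq_b1.
    case: (boolP (is_sign _)) => [ub'|_]; last by rewrite addr0.
    case: eij; rewrite !inE; apply/or3P; move: ub ub'.
    have [->|->] := sign_sq b j; move=> /orP[]/eqP-> /orP[]/eqP E;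
      by [apply: Or31; apply/eqP; lra | apply: Or32; apply/eqP; lra |
          apply: Or33; apply/eqP; lra].
  have : \sum_b (P b && Q b)%:R + \sum_b (P b && Q (flip j b))%:R <=
      \sum_b (P b)%:R :> R by rewrite -big_split; apply: ler_sum => b _; exact: h.
  have : 0 <= \sum_b (P b)%:R :> R by apply: sumr_ge0.
  rewrite -flipE//; lra.
have [j [j' [jD j'D ej ej' /eqP jj']]] : exists j j', [/\ j \notin D, j' \notin D,
    e i j != 0, e i j' != 0 & j <> j'].
  apply: contrapT => none; apply: nsp; split=> // j j' jD j'D ej ej'.
  by apply: contrapT => jj'; apply: none; exists j, j'.
(* Two nonzero errors: among the four flips at [j] and [j'], at most three pass. *)
have h b : (P b && Q b)%:R + (P b && Q (flip j b))%:R + (P b && Q (flip j' b))%:R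
    + (P b && Q (flip j (flip j' b)))%:R <= 3 * (P b)%:R :> R.
  case: (P b) => /=; last by rewrite !addr0 mulr0.
  rewrite /Q !u_flip ?notZ// flip_other//.
  have nz : e i j * x b j != 0 by rewrite mulf_neq0// signr_eq0.
  have nz' : e i j' * x b j' != 0 by rewrite mulf_neq0// signr_eq0.
  move: (e i j * x b j) (e i j' * x b j') (u y i b) nz nz' => al be v al0 be0.
  by rewrite mulr1; exact: four_signs.
have e1 := flipE j jD; have e2 := flipE j' j'D.
have e3 : \sum_b (P b && Q b)%:R = \sum_b (P b && Q (flip j (flip j' b)))%:R :> R.
  rewrite e1 (sum_flip j'); apply: eq_bigr => b _.
  by rewrite /P (pass_flip _ _ ZD eD j'D).
have : \sum_b (P b && Q b)%:R + \sum_b (P b && Q (flip j b))%:R +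
    \sum_b (P b && Q (flip j' b))%:R + \sum_b (P b && Q (flip j (flip j' b)))%:R <=
    3 * \sum_b (P b)%:R :> R.
  by rewrite mulr_sumr -!big_split; apply: ler_sum => b _; exact: h.
rewrite -e1 -e2 -e3; lra.
Qed.

(** Union bound over [y]: the true coordinates of the structured part have size at most [K * n], so
    every good [b] passes for one of [(2 K n + 1) ^ d] frozen values. Hence [T] bad rows would leave
    too few good vectors. *)
Lemma sparse_exists T : (K * n).*2.+1%:R ^+ d * (3 / 4) ^+ T * 2 ^+ n < #|good|%:R :> R ->
  exists D : {set 'I_n}, [/\ Z \subset D, (#|D| <= #|Z| + T * mu)%N & sparse D].
Proof.
move=> big; apply: contrapT => none.
have st T' : (T' <= T)%N -> exists D rows, state T' D rows.
  elim: T' => [_|T' IH TT'].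
    exists Z, [::]; split=> // [|y]; first by rewrite addn0.
    rewrite /pass/= sumr_const expr0 mul1r card_ffun card_bool card_ord.
    by rewrite natrX.
  have [D [rows st]] := IH (ltnW TT').
  apply: (sparse_step st) => sp; apply: none; exists D.
  case: st => ZD Dle _ _; split=> //; apply: leq_trans Dle _.
  by rewrite leq_add2l leq_mul2r (ltnW TT') orbT.
have [D [rows [_ _ _ cnt]]] := st T (leqnn T).
pose Y b s : int := \sum_(j | j \notin Z) kap j s * (-1) ^+ (b : B) j.
pose N := (K * n)%N.
have YN b s : (`|Y b s| <= N)%N.
  rewrite /Y; apply: (@leq_trans (\sum_(j | j \notin Z) K)%N).
    elim/big_rec2: _ => // j y1 y2 jZ le12.
    apply: (@leq_trans (`|(kap j s * (-1) ^+ (b : B) j)%R| + `|y2|)%N); first by lia.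
    rewrite leq_add// abszM.
    by rewrite (_ : `|((-1) ^+ b j)%R|%N = 1%N) ?muln1 ?kapK//; case: (b j).
  by rewrite sum_nat_const mulnC leq_mul2l (leq_trans (max_card _)) ?card_ord ?orbT.
pose dec (y : {ffun 'I_d -> 'I_N.*2.+1}) s : int := (y s)%:Z - N%:Z.
suff : #|good|%:R <= (K * n).*2.+1%:R ^+ d * (3 / 4) ^+ T * 2 ^+ n :> R.
  by move=> /(lt_le_trans big); rewrite ltxx.
apply: (@le_trans _ _ (\sum_(y : {ffun 'I_d -> 'I_N.*2.+1}) \sum_b (pass (dec y) rows b)%:R)).
  rewrite exchange_big/= -sum1_card natr_sum big_mkcond; apply: ler_sum => b _.
  case: ifPn => bg; last by apply: sumr_ge0.
  pose y0 : {ffun 'I_d -> 'I_N.*2.+1} := [ffun s => inord `|Y b s + N%:Z|].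
  have decY : dec y0 = Y b.
    apply/funext => s; rewrite /dec ffunE inordK; have := YN b s; lia.
  rewrite (bigD1 y0)//= decY (_ : pass _ _ _ = true); first by rewrite ler_wpDr// sumr_ge0.
  by apply/allP => i _; exact: u_good.
apply: (@le_trans _ _ (\sum_(y : {ffun 'I_d -> 'I_N.*2.+1}) (3 / 4) ^+ T * 2 ^+ n)).
  by apply: ler_sum => y _; exact: cnt.
rewrite sumr_const card_ffun !card_ord -mulrA -[leLHS]mulr_natl natrX.
by [].
Qed.

End SparseRows.

(** * Assembling the structure *)

(** Starting from the empty tuple, which is dissociated at any level, rows are added as long as
    robustness in the next dimension persists. *)
Lemma robust_maximal (R : realFieldType) p n (M : 'M[R]_(p, n)) (L mu : nat -> nat) D :
  (forall I : {set 'I_p}, (#|I| <= D)%N -> ~ robust M I (L D) (mu D) D) ->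
  exists d (I : {set 'I_p}), [/\ (d < D)%N, (#|I| <= d)%N, robust M I (L d) (mu d) d &
    forall i, ~ robust M (i |: I) (L d.+1) (mu d.+1) d.+1].
Proof.
move=> top; apply: contrapT => none.
have H d : (d <= D)%N -> exists2 I : {set 'I_p}, (#|I| <= d)%N & robust M I (L d) (mu d) d.
  elim: d => [_|d IHd dD].
    exists finset.set0; first by rewrite cards0.
    move=> U _; exists [ffun i => widen_ord (leq0n n) i]; first by case.
    by move=> c _ _ [].
  have [I Id rob] := IHd (ltnW dD).
  apply: contrapT => no; apply: none; exists d, I; split=> // i robi; apply: no.
  exists (i |: I) => //; apply: leq_trans (leq_card_setU _ _).1 _.
  by rewrite cards1 ltnS.
have [I ID rob] := H D (leqnn D); exact: top ID rob.
Qed.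

Lemma maximal_structure (R : realFieldType) p n (M : 'M[R]_(p, n)) (I : {set 'I_p})
    d l alpha G L L0 mu mu0 (i0 : 'I_p) :
  (2 <= l)%N -> (0 < L <= (2 ^ l) ^ alpha)%N -> (d.+1 * L ^ d.+3 <= L0)%N ->
  ((2 ^ l) ^ ((4 + 2 * alpha) * G) * (2 ^ l) ^ 2 * L ^ 2 *
     (l * (4 + 2 * alpha) * G).+1 <= L0)%N ->
  (mu + mu <= mu0)%N ->
  robust M I L0 mu0 d -> (forall i, ~ robust M (i |: I) L mu d.+1) ->
  (2 ^ l)%:R^-1 ^+ G <=
    lazy_walk [seq colr M I j | j <- enum 'I_n] (@origin R _) 0 ->
  exists (Z : {set 'I_n}) (U : 'I_p -> {set 'I_n}) (kap : 'I_n -> 'I_d -> int)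
      (g : 'I_p -> 'I_d -> R),
  [/\ (#|Z| <= mu + (2 ^ l) ^ 2 * (l * (4 + 2 * alpha) * G).+1)%N,
      forall i, (#|U i| <= mu)%N,
      forall j s, j \notin Z -> (`|kap j s| <= (2 ^ l) ^ ((4 + 2 * alpha) * G) * L)%N &
      forall i j, j \notin Z -> j \notin U i -> M i j = \sum_s (kap j s)%:~R * g i s].
Proof.
move=> l2 /andP[L1 Lk] LL0 LL0' mu2 rob nrob energy.
have LleL0 : (L <= L0)%N.
  apply: leq_trans LL0; rewrite expnS mulnCA leq_pmulr//.
  by rewrite muln_gt0 expn_gt0 L1.
have [U UP] : exists U : 'I_p -> {set 'I_n}, forall i, (#|U i| <= mu)%N /\
    forall t : {ffun 'I_d.+1 -> 'I_n}, (forall s, t s \notin U i) ->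
      ~ dissociated M (i |: I) L t.
  have H i : exists U : {set 'I_n}, (#|U| <= mu)%N /\
    forall t : {ffun 'I_d.+1 -> 'I_n}, (forall s, t s \notin U) ->
      ~ dissociated M (i |: I) L t.
    have /existsNP[U /not_implyP[Umu nU]] := nrob i.
    by exists U; split=> // t tU dt; apply: nU; exists t.
  by have [U UP] := choice H; exists U.
have IU i : I \subset i |: I by exact: finset.subsetUr.
have [|t0 t0U dt0] := rob (U i0).
  by apply: leq_trans mu2; rewrite (leq_trans (UP i0).1)// leq_addr.
have [ab abP] : exists ab : 'I_n -> int * ('I_d -> int), forall j, j \notin U i0 ->
    related M I L t0 j (ab j).1 (ab j).2.
  have H j : exists ab : int * ('I_d -> int), j \notin U i0 ->
      related M I L t0 j ab.1 ab.2.
    have [jU|jU] := boolP (j \in U i0); first by exists (0, fun=> 0).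
    have [|a [b rel]] := relatedP (j := j) (IU i0) LleL0 dt0.
      by apply: (UP i0).2 => s; rewrite ffunE; case: (unlift _ _).
    by exists (a, b) => _; exact: related_sub (IU i0) rel.
  by have [ab abP] := choice H; exists ab.
have [N [Z [/andP[N0 NG] UZ Zle dvd]]] :=
  common_denominator l2 Lk LL0' dt0 abP energy.
have rows i : exists v : 'cV[R]_d, forall j, j \notin U i0 -> j \notin U i ->
    M i j = (coords R (ab j).1 (ab j).2 *m v) 0 0.
  (* The tuple for row [i] has to avoid two exceptional sets at once, which is why [mu0] is at least
     twice [mu]. *)
  have [|t1 t1U dt1] := rob (U i0 :|: U i).
    apply: leq_trans mu2; apply: leq_trans (leq_card_setU _ _).1 _.
    by rewrite leq_add// (UP _).1.
  apply: (row_functional LL0 dt0 dt1 t0U _ _ (IU i0) (IU i) (finset.setU11 i I) L1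
    (UP i0).2 (UP i).2 abP) => s; have := t1U s; rewrite inE negb_or => /andP[] //.
have [v vP] := choice rows.
(* The common denominator [N] is moved from the coordinates into the generators. *)
exists Z, U, (fun j s => (N%:Z * (ab j).2 s %/ (ab j).1)%Z), (fun i s => v i s 0 / N%:R).
split.
- by apply: leq_trans Zle _; rewrite leq_add2r (UP i0).1.
- by move=> i; exact: (UP i).1.
- move=> j s jZ; have jU : j \notin U i0 by apply: contra jZ; exact: (fintype.subsetP UZ).
  have [a0 aL bL _] := abP j jU.
  rewrite -(leq_pmul2r (_ : 0 < `|(ab j).1|)%N) ?absz_gt0// -abszM divzK ?dvd//.
  rewrite abszM absz_nat -[leqLHS]muln1 leq_mul ?absz_gt0//.
  by rewrite leq_mul.
- move=> i j jZ jUi; have jU : j \notin U i0 by apply: contra jZ; exact: (fintype.subsetP UZ).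
  have [a0 _ _ _] := abP j jU.
  rewrite (vP i j jU jUi) mxE; apply: eq_bigr => s _; rewrite mxE.
  have a0' : (ab j).1%:~R != 0 :> R by rewrite intr_eq0.
  have N0' : N%:R != 0 :> R by rewrite pnatr_eq0 -lt0n.
  have := divzK (dvd j s jZ) => /(congr1 (fun x : int => x%:~R : R)).
  rewrite !rmorphM/= => E.
  have -> : (N%:Z * (ab j).2 s %/ (ab j).1)%Z%:~R = N%:R * ((ab j).2 s)%:~R / (ab j).1%:~R :> R.
    by rewrite -[N%:R]/(N%:Z%:~R) -E mulfK.
  by field; rewrite N0' a0'.
Qed.

(** * Choice of levels and exponents *)

Lemma exp2_ge_linear c l : (4 * c.+1 <= l)%N -> (l * c < 2 ^ l)%N.
Proof.
move=> cl; pose m := l./2.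
have lm : l = (odd l + m.*2)%N by rewrite odd_double_half.
have m2 : (2 * c.+1 <= m)%N by case: (odd l) lm; lia.
have mm : (m < 2 ^ m)%N by exact: ltn_expl.
have le1 : (2 ^ m * 2 ^ m <= 2 ^ l)%N.
  by rewrite -expnD leq_exp2l// addnn lm leq_addl.
have l2 : (l <= m.*2.+1)%N by case: (odd l) lm; lia.
nia.
Qed.

(* Tuples of size d are taken at level k ^ level D G (D - d); each step leaves
   room for the coefficients in [coords_comp] and [common_denominator]. *)
Fixpoint level (D G t : nat) : nat :=
  if t is t'.+1 then
    let x := level D G t' in (D + 5) * x + (4 + 2 * x) * G + 4
  else 2.

Lemma level_mono D G t t' : (t <= t')%N -> (level D G t <= level D G t')%N.
Proof.
move=> /subnK <-; elim: (t' - t)%N => //= m IHm.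
by rewrite (leq_trans IHm)// -addnA (leq_trans _ (leq_addr _ _))// leq_pmull; lia.
Qed.

(** The extra unit in the exponent is a spare factor [k] that pays for [d.+1] in [coords_comp]. *)
Lemma level_ge D G x d : (d < D)%N ->
  ((x * d.+3).+1 <= (D + 5) * x + (4 + 2 * x) * G + 4)%N.
Proof.
move=> dD; have : (x * d.+3 <= (D + 5) * x)%N by rewrite mulnC leq_mul2r; lia.
move: (_ * G)%N (_ * x)%N (x * _)%N; lia.
Qed.

(** The last unit on the left pays for the factor linear in [l] in [common_denominator]. *)
Lemma level_ge' D G x :
  ((4 + 2 * x) * G + 2 + x * 2 + 1 <= (D + 5) * x + (4 + 2 * x) * G + 4)%N.
Proof.
have : (2 * x <= (D + 5) * x)%N by rewrite leq_mul2r; lia.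
move: ((4 + _) * G)%N ((D + 5) * x)%N; lia.
Qed.

(** Since [(3/4)^3 < 1/2], three tests gain more than a factor 2. *)
Lemma three_quarters_lt (R : realFieldType) l s : (0 < l * s)%N ->
  (3 / 4) ^+ (3 * (l * s)) < (2 ^ l)%:R^-1 ^+ s :> R.
Proof.
move=> ls0; have -> : (2 ^ l)%:R^-1 = 2^-1 ^+ l :> R by rewrite natrX exprVn.
rewrite -[X in _ < X]exprM exprM ltrXn2r -?lt0n//; lra.
Qed.

Lemma structure_outside_columns (R : realFieldType) (G : nat) :
  exists c A D l0 : nat, forall l p n (M : 'M[R]_(p, n)) (good : {set {ffun 'I_n -> bool}}),
  (l0 <= l)%N -> (0 < p)%N -> (n <= (2 ^ l) ^ G)%N ->
  (forall b i, b \in good ->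
     (\sum_j M i j * (-1) ^+ b j == 1) || (\sum_j M i j * (-1) ^+ b j == -1)) ->
  (2 ^ l)%:R^-1 ^+ G <= #|good|%:R / 2 ^+ n :> R ->
  exists (X : {set 'I_n}) (d : nat) (kap : 'I_n -> 'I_d -> int) (g : 'I_p -> 'I_d -> R),
  [/\ (#|X| <= c * (2 ^ l) ^ 3)%N, (d <= D)%N,
      forall j s, j \notin X -> (`|kap j s| <= (2 ^ l) ^ A)%N &
      forall i,
        (forall j, j \notin X -> M i j - \sum_s (kap j s)%:~R * g i s \in [:: -1; 0; 1]) /\
        (forall j j', j \notin X -> j' \notin X ->
           M i j - \sum_s (kap j s)%:~R * g i s != 0 ->
           M i j' - \sum_s (kap j' s)%:~R * g i s != 0 -> j = j')].
Proof.
pose D := (4 * G).+1; pose G' := (2 * G + D)%N.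
pose xm := level D G' D; pose c0 := ((4 + 2 * xm) * G' + D + 2)%N.
pose Am := ((4 + 2 * xm) * G' + xm)%N.
pose sm := ((Am + G + 1) * D + G + 1)%N.
exists (D * 2 ^ D + 1 + 3 * sm * (D * 2 ^ D))%N, Am, D, (4 * c0.+1)%N.
move=> l p n M good l0l p0 nk goodP good_ge.
have lc0 := exp2_ge_linear l0l.
have l4 : (4 <= l)%N by rewrite (leq_trans _ l0l)// leq_pmulr.
set k := (2 ^ l)%N in lc0 nk good_ge *.
have k0 : (0 < k)%N by rewrite expn_gt0.
have k4 : (4 <= k)%N by rewrite -[4%N]/(2 ^ 2)%N leq_exp2l// ltnW// ltnW.
have kR : 0 < k%:R :> R by rewrite ltr0n.
have energy (I : {set 'I_p}) : (#|I| <= D)%N -> k%:R^-1 ^+ (2 * G) <=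
    2 ^+ D * lazy_walk [seq colr M I j | j <- enum 'I_n] (@origin R _) 0.
  move=> ID; have := energy_ge (I := I) (fun b i bg _ => goodP b i bg).
  have p_ge0 := posdef_ge0 (posdef_walk [seq colr M I j | j <- enum 'I_n]
    (posdef_origin R 'cV[R]_p)).
  move=> le1; apply: (@le_trans _ _ ((#|good|%:R / 2 ^+ n) ^+ 2)).
    rewrite mulnC exprM; apply: lerXn2r good_ge.
      by rewrite nnegrE exprn_ge0// invr_ge0 ler0n.
    by rewrite nnegrE divr_ge0 ?exprn_ge0.
  apply: le_trans le1 _; rewrite ler_wpM2r//.
  by rewrite -!natrX ler_nat leq_exp2l.
(* [mu] doubles when [d] drops by one, leaving room for two exceptional sets; at [d = D] it is what
   [k ^ 2] disjoint tuples require. *)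
pose L d := (k ^ level D G' (D - d))%N; pose mu d := (D * k ^ 2 * 2 ^ (D - d))%N.
have top (I : {set 'I_p}) : (#|I| <= D)%N -> ~ robust M I (L D) (mu D) D.
  move=> ID rob; have := energy I ID.
  have := robust_energy (l := l) _ _ rob; rewrite -/k /L /mu subnn.
  move=> /(_ (leqnn _)) le1; have {}le1 := le1 _; move: le1.
  rewrite expn0 muln1 mulnC => /(_ (leqnn _)) le1 le2.
  have : k%:R^-1 ^+ (2 * G) <= 2 ^+ D * k%:R^-1 ^+ D :> R.
    by apply: le_trans le2 _; rewrite ler_wpM2l// exprn_ge0.
  rewrite !exprVn ler_pdivlMr ?exprn_gt0// mulrC -ler_pdivlMr ?invr_gt0 ?exprn_gt0//.
  rewrite invrK -!natrX -natrM ler_nat -!expnM -expnD leq_exp2l// /D; nia.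
have [d [I [dD Id rob nrob]]] := robust_maximal top.
set x := level D G' (D - d.+1).
have xxm : (x <= xm)%N by apply: level_mono; exact: leq_subr.
have LdS : L d.+1 = (k ^ x)%N by [].
have Ld : L d = (k ^ ((D + 5) * x + (4 + 2 * x) * G' + 4))%N.
  by rewrite /L /x -(subnSK dD).
have Dk : (D < k)%N.
  apply: leq_ltn_trans lc0; apply: leq_trans (leq_pmull c0 (ltnW (ltnW (ltnW l4)))).
  by rewrite /c0 -addnA addnCA leq_addr.
have kTx : ((l * (4 + 2 * x) * G').+1 <= k)%N.
  apply: leq_ltn_trans lc0; rewrite -mulnA leq_mul2l; apply/orP; right.
  rewrite /c0 -addnA (leq_trans _ (leq_addr _ _))// leq_mul2r leq_add2l leq_mul2l.
  by rewrite xxm !orbT.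
have [||||||Z [U [kap [g [Zle Ule kaple kapE]]]]] :=
  @maximal_structure R p n M I d l x G' (L d.+1) (L d) (mu d.+1) (mu d) (Ordinal p0)
    _ _ _ _ _ rob nrob.
- exact: leq_trans l4.
- by rewrite LdS expn_gt0 k0 leqnn.
- rewrite LdS Ld -expnM; apply: (@leq_trans (k * k ^ (x * d.+3))%N).
    by rewrite leq_mul2r (leq_trans dD (ltnW Dk)) orbT.
  by rewrite -expnS leq_pexp2l// level_ge.
- rewrite LdS Ld -/k; apply: leq_trans (leq_mul (leqnn _) kTx) _.
  by rewrite -expnM -!expnD -expnSr leq_pexp2l// -addn1 level_ge'.
- by rewrite addnn -mul2n mulnCA -expnS /mu subnSK.
- have := energy I (leq_trans Id (ltnW dD)); rewrite -/k /G' exprD => le1.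
  rewrite mulrC -ler_pdivlMl ?exprn_gt0 ?invr_gt0//.
  apply: le_trans le1 _; rewrite ler_wpM2r//.
    exact: posdef_ge0 (posdef_walk _ (posdef_origin _ _)).
  by rewrite exprVn invrK -!natrX ler_nat leq_exp2r ?(leq_trans _ k4).
pose s := (((4 + 2 * x) * G' + x + G + 1) * d + G + 1)%N.
have xAm : ((4 + 2 * x) * G' + x <= Am)%N.
  by apply: leq_add => //; rewrite leq_mul2r leq_add2l leq_mul2l xxm !orbT.
have s_sm : (s <= sm)%N.
  by rewrite /s /sm !leq_add2r leq_mul ?(ltnW dD)// !leq_add2r.
rewrite -/k in kaple Zle; rewrite LdS in kaple.
have e_supp i j : j \notin Z -> j \notin U i ->
    M i j - \sum_s (kap j s)%:~R * g i s = 0.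
  by move=> jZ jU; rewrite (kapE i j jZ jU) subrr.
have [|X [ZX Xle Xsparse]] := @sparse_exists R p n d M good Z U kap g _ (mu d.+1)
    (fun b i bg => goodP b i bg) kaple Ule e_supp (3 * (l * s))%N.
  have s0 : (0 < l * s)%N by rewrite muln_gt0 (leq_trans _ l4)// /s addn1.
  apply: lt_le_trans (_ : k%:R^-1 ^+ G * 2 ^+ n <= _); last first.
    by rewrite -ler_pdivlMr ?exprn_gt0.
  rewrite ltr_pM2r ?exprn_gt0//.
  set e := ((4 + 2 * x) * G' + x + G + 1)%N in s s_sm s0 *.
  have Kn : ((k ^ ((4 + 2 * x) * G') * k ^ x * n).*2.+1 <= k ^ e)%N.
    have lin u v : (u <= v)%N -> (0 < v)%N -> (u.*2.+1 <= k * v)%N.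
      move=> uv v0; apply: leq_trans (leq_mul k4 (leqnn v)); lia.
    rewrite /e addn1 expnS !expnD; apply: lin; first by rewrite leq_mul2l nk orbT.
    by rewrite !muln_gt0 !expn_gt0.
  apply: lt_le_trans (_ : (k ^ e)%:R ^+ d * k%:R^-1 ^+ s <= _).
    apply: le_lt_trans (_ : _ <= (k ^ e)%:R ^+ d * (3 / 4) ^+ (3 * (l * s))) _.
      rewrite ler_wpM2r ?exprn_ge0 ?divr_ge0// lerXn2r ?nnegrE//.
      by rewrite ler_nat.
    rewrite ltr_pM2l ?exprn_gt0 ?ltr0n ?expn_gt0 ?k0//.
    exact: three_quarters_lt.
  rewrite natrX -exprM /s -addnA exprD mulrA -exprMn mulfV ?gt_eqF// expr1n mul1r.
  rewrite addn1; apply: ler_wiXn2l => //; rewrite ?invr_ge0 ?ltW//.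
  by rewrite invf_lt1// ltr1n (leq_trans _ k4).
exists X, d, kap, g; split=> //.
- have muD : (mu d.+1 <= D * 2 ^ D * k ^ 2)%N.
    by rewrite /mu mulnAC leq_mul2r leq_mul2l leq_exp2l// leq_subr !orbT.
  have lk : (l <= k)%N by rewrite ltnW// ltn_expl.
  have kZ : (k ^ 2 * (l * (4 + 2 * x) * G').+1 <= k ^ 3)%N.
    by rewrite [leqRHS]expnSr leq_mul2l kTx orbT.
  have lsm : (l * s * mu d.+1 <= sm * (D * 2 ^ D) * k ^ 3)%N.
    apply: leq_trans (leq_mul (leq_mul lk s_sm) muD) _.
    by rewrite expnSr; move: (2 ^ D)%N (k ^ 2)%N => *; apply/eq_leq; ring.
  have k23 : (D * 2 ^ D * k ^ 2 <= D * 2 ^ D * k ^ 3)%N.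
    by rewrite leq_mul2l leq_pexp2l ?orbT.
  have -> : ((D * 2 ^ D + 1 + 3 * sm * (D * 2 ^ D)) * k ^ 3 =
      D * 2 ^ D * k ^ 3 + k ^ 3 + 3 * (sm * (D * 2 ^ D) * k ^ 3))%N.
    by move: (2 ^ D)%N (k ^ 3)%N => *; ring.
  apply: leq_trans Xle _; rewrite leq_add//; last by rewrite -mulnA leq_mul2l.
  by apply: leq_trans Zle _; rewrite leq_add// (leq_trans muD).
- exact: ltnW.
- move=> j s' jX; have jZ : j \notin Z by apply: contra jX; exact: (fintype.subsetP ZX).
  by apply: leq_trans (kaple j s' jZ) _; rewrite -expnD leq_pexp2l.
Qed.

(** * The theorem *)

(** The progression need not be proper, so the number of coefficient vectors only bounds its
    size. *)
Lemma GAP_card (Z : zmodType) r (g0 : Z) (g : 'I_r -> Z) (K : nat) :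
  exists2 m : nat, (GAP g0 g (fun=> - K%:Z) (fun=> K%:Z) #= `I_m)%card &
    (m <= K.*2.+1 ^ r)%N.
Proof.
pose T := {ffun 'I_r -> 'I_K.*2.+1}.
pose f (t : 'I_#|T|) : Z := g0 + \sum_(i < r) g i *~ ((enum_val t i)%:Z - K%:Z).
have sub : (GAP g0 g (fun=> - K%:Z) (fun=> K%:Z) `<=` f @` [set: 'I_#|T|])%classic.
  move=> z [k kK ->].
  exists (enum_rank [ffun i => inord `|k i + K%:Z|]) => //.
  rewrite /f enum_rankK; congr (_ + _); apply: eq_bigr => i _; congr (_ *~ _).
  by rewrite ffunE inordK; have := kK i; lia.
have le1 : (GAP g0 g (fun=> - K%:Z) (fun=> K%:Z) #<= `I_#|T|)%card.
  apply: card_le_trans (subset_card_le sub) _.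
  by rewrite (card_le_eqr card_II); exact: card_image_le.
have [m Gm] : finite_set (GAP g0 g (fun=> - K%:Z) (fun=> K%:Z)).
  by apply/finite_set_leP; exists #|T|.
exists m => //; rewrite -[X in (_ <= X ^ _)%N]card_ord -[X in (_ <= _ ^ X)%N](card_ord r).
by rewrite -card_ffun -card_le_II -(card_le_eql Gm).
Qed.

Lemma enum_val_ltn n (A : {set 'I_n}) (i j : 'I_#|A|) :
  (i < j)%N -> (enum_val i < enum_val j)%N.
Proof.
move=> ij; have x0 := enum_val i.
rewrite !(enum_val_nth x0) -!(nth_map x0 0%N val) -?cardE//.
have srt : sorted ltn [seq val i | i <- enum A].
  apply: (subseq_sorted ltn_trans (s2 := iota 0 n)); last exact: iota_ltn_sorted.
  by rewrite -val_enum_ord; apply: map_subseq; rewrite [enum (ordinal n)]enumT; exact: filter_subseq.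
by apply: (sorted_ltn_nth ltn_trans 0%N srt) ij; rewrite inE size_map -cardE.
Qed.

Lemma leq_exp_base m n e : (m <= n)%N -> (m ^ e <= n ^ e)%N.
Proof. by case: e => // e; rewrite leq_exp2r. Qed.

Theorem theorem2p6 (R : realType) (eps C : R)
    (eps_gt0 : 0 < eps) (eps_lt1 : eps < 1) (C_gt0 : 0 < C) :
  exists (c A : R) (r0 : nat),
  forall (n : nat) (M : 'M[R]_n),
    (0 < n)%N ->
    n%:R `^ (- C) <= s0 M ->
    exists (n1 n2 : nat) (rows : 'I_n1 -> 'I_n) (cols : 'I_n2 -> 'I_n),
    [/\ forall i j : 'I_n1, (i < j)%N -> (rows i < rows j)%N,
        forall i j : 'I_n2, (i < j)%N -> (cols i < cols j)%N,
        n%:R - n1%:R <= c * n%:R `^ (1 - eps),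
        n%:R - n2%:R <= c * n%:R `^ (1 - eps) &
        exists (r : nat) (g : 'I_r -> 'cV[R]_n1)
               (g0 : 'cV[R]_n1) (K K' : 'I_r -> int)
               (M'' F : 'M[R]_(n1, n2)) (size_Q : nat),
        [/\ (r <= r0)%N,
            mxsub rows cols M = M'' + F,
            sparse_sign_matrix F,
            (GAP g0 g K K' #= `I_size_Q)%card /\
              size_Q%:R <= n%:R `^ A &
            forall j : 'I_n2, GAP g0 g K K' (col j M'')]].
Proof.
have dbl (v : nat) : (0 < v)%N -> (v.*2.+1 <= 2 ^ 2 * v)%N by lia.
have b0 : 0 < 1 - eps by rewrite subr_gt0.
have be3 : (1 - eps) / 3 <= 1 by lra.
set be := 1 - eps in b0 be3 *.
pose G := ((Num.truncn (6 / be)).+1 + (Num.truncn (6 * C / be)).+1)%N.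
have G1 : 6 / be <= G%:R.
  have /andP[_ /ltW le1] := truncn_itv (divr_ge0 (ler0n R 6) (ltW b0)).
  by apply: le_trans le1 _; rewrite ler_nat leq_addr.
have G2 : 6 * C / be <= G%:R.
  have x0 : 0 <= 6 * C / be by rewrite divr_ge0 ?mulr_ge0// ltW.
  have /andP[_ /ltW le1] := truncn_itv x0.
  by apply: le_trans le1 _; rewrite ler_nat leq_addl.
have [c [A [D [l0 core]]]] := structure_outside_columns R G.
(* The second summand of [c'] covers small [n]: if [l < l1], then [n <= (2 ^ l1) ^ (3 / be)] and all
   columns may be dropped. *)
pose l1 := maxn l0 1; pose c' : R := c%:R + (2 ^+ l1) `^ (3 / be).
have c'0 : 0 <= c' by rewrite addr_ge0// powR_ge0.
(* With [k = 2 ^ l] and [N = k ^ A], each generator contributes at most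
   [2 N + 1 <= 4 N <= k ^ (A + 2)] coefficients, and [k <= n]. *)
exists c', ((A + 2) * D)%:R, D => n M n0 Ms0.
have n1 : 1 <= n%:R :> R by rewrite ler1n.
have powR_ge1 (e : R) : 0 <= e -> 1 <= n%:R `^ e :> R by move=> e0; have := ler_powR n1 e0; rewrite /= powRr0.
have nb1 := powR_ge1 _ (ltW b0).
pose y := n%:R `^ (be / 3) : R.
have y1 : 1 <= y by rewrite powR_ge1// divr_ge0 ?ltW.
have ny : n%:R = y `^ (3 / be).
  rewrite -powRrM (_ : be / 3 * (3 / be) = 1) ?powRr1//.
  by field; rewrite gt_eqF.
(* [2 ^ l] is the largest power of 2 up to [n ^ (be / 3)], so a loss of [c * (2 ^ l) ^ 3] columns is
   at most [c * n ^ be]. *)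
pose t := Num.truncn y; pose l := trunc_log 2 t.
have /andP[ty yt] := truncn_itv (le_trans ler01 y1); rewrite -/t in ty yt.
have t0 : (0 < t)%N by rewrite -(ltr_nat R); lra.
have ly : (2 ^ l)%:R <= y by apply: le_trans ty; rewrite ler_nat trunc_logP.
have yl : y <= (2 ^ l.+1)%:R.
  by apply: le_trans (ltW yt) _; rewrite ler_nat trunc_log_ltn.
have e30 : 0 <= 3 / be by rewrite divr_ge0// ltW.
have [ll1|l1l] := ltnP l l1.
  exists n, 0, id, (fun=> Ordinal n0).
  split=> //.
  - by move=> [].
  - by rewrite subrr mulr_ge0// powR_ge0.
  - rewrite subr0; apply: (@le_trans _ _ c'); last by rewrite ler_peMr.
    apply: (@le_trans _ _ ((2 ^+ l1) `^ (3 / be))); last by rewrite lerDr.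
    rewrite ny ge0_ler_powR ?nnegrE ?(le_trans ler01 y1) ?exprn_ge0//.
    by apply: le_trans yl _; rewrite -natrX ler_nat leq_exp2l.
  exists 0, (fun=> 0), 0, (fun=> - 0%:Z), (fun=> 0%:Z), 0, (mxsub id (fun=> Ordinal n0) M).
  have [m Gm m1] := GAP_card (0 : 'cV[R]_n) (fun _ : 'I_0 => 0) 0.
  exists m; split.
  - exact: leq0n.
  - by rewrite add0r.
  - split=> [i []//|i]; apply: leq_trans (max_card _) _.
    by rewrite card_ord.
  - split=> //; apply: le_trans (powR_ge1 _ (ler0n R _)).
    by rewrite -[1]/(1%:R) ler_nat.
  - by move=> [].
have l_gt0 : (0 < l)%N by rewrite (leq_trans _ l1l)// leq_maxr.
have k1 : 1 <= (2 ^ l)%:R :> R by rewrite ler1n expn_gt0.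
(* Uses [n ^ (be / 3) <= 2 ^ l.+1 <= (2 ^ l) ^ 2]. The cases [e = 1] and [e = C] explain the two
   summands of [G]. *)
have nkG e : 0 <= e -> n%:R `^ e <= (2 ^ l)%:R `^ (6 * e / be).
  move=> e0; rewrite ny -powRrM (_ : 6 * e / be = 2%:R * (3 / be * e)); last by ring.
  rewrite [X in _ <= X]powRrM powR_mulrn ?(le_trans ler01)//.
  rewrite ge0_ler_powR ?nnegrE ?(mulr_ge0 e30 e0) ?(le_trans ler01 y1) ?exprn_ge0//.
  apply: le_trans yl _; rewrite -natrX ler_nat -expnM leq_exp2l//.
  by rewrite muln2 -addnn -addn1 leq_add2l.
have nk : (n <= (2 ^ l) ^ G)%N.
  rewrite -(ler_nat R) natrX -powR_mulrn ?(le_trans ler01)//.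
  rewrite -[n%:R]powRr1//; apply: le_trans (nkG _ ler01) _.
  by rewrite mulr1 ler_powR.
pose good := [set b : {ffun 'I_n -> bool} | M *m sign_vector R b \in cube R n]%SET.
have goodP b i : b \in good ->
    (\sum_j M i j * (-1) ^+ b j == 1) || (\sum_j M i j * (-1) ^+ b j == -1).
  rewrite inE => /forallP/(_ i); rewrite orbC mxE.
  by under eq_bigr do rewrite mxE.
have good_ge : (2 ^ l)%:R^-1 ^+ G <= #|good|%:R / 2 ^+ n :> R.
  have s0E : s0 M = #|good|%:R / 2 ^+ n.
    by rewrite /s0 card_ffun card_bool card_ord natrX.
  rewrite -s0E; apply: le_trans Ms0.
  rewrite powRN exprVn lef_pV2 ?posrE ?powR_gt0 ?exprn_gt0 ?ltr0n ?expn_gt0//.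
  apply: le_trans (nkG _ (ltW C_gt0)) _.
  by rewrite -powR_mulrn ?(le_trans ler01)// ler_powR.
have [|X [d [kap [g [Xle dD kaple Fsp]]]]] := core l n n M good _ n0 nk goodP good_ge.
  by apply: leq_trans l1l; exact: leq_maxl.
pose N := ((2 ^ l) ^ A)%N.
exists n, #|~: X|%SET, id, (fun j => enum_val j).
have colsX j : @enum_val _ (mem (~: X)%SET) j \notin X.
  by have := enum_valP j; rewrite inE.
split=> //.
- by move=> i j; exact: enum_val_ltn.
- by rewrite subrr mulr_ge0// powR_ge0.
- rewrite -[X in X%:R - _](card_ord n) -(cardsC X) natrD addrK.
  apply: (@le_trans _ _ (c * (2 ^ l) ^ 3)%:R); first by rewrite ler_nat.
  rewrite natrM ler_pM// ?lerDl ?powR_ge0// natrX.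
  rewrite (_ : n%:R `^ be = y ^+ 3); first by rewrite lerXn2r ?nnegrE ?(le_trans ler01 y1).
  by rewrite -powR_mulrn ?(le_trans ler01 y1)// -powRrM divfK// pnatr_eq0.
pose gens (s : 'I_d) : 'cV[R]_n := \col_i g i s.
have [m Gm mle] := GAP_card (0 : 'cV[R]_n) gens N.
pose M2 : 'M[R]_(n, #|~: X|%SET) :=
  \matrix_(i, j) \sum_s (kap (enum_val j) s)%:~R * g i s.
exists d, gens, 0, (fun=> - N%:Z), (fun=> N%:Z), M2, (mxsub id (fun j => enum_val j) M - M2), m.
split=> //.
- by rewrite addrC subrK.
- split=> [i j|i]; first by rewrite !mxE; exact: (Fsp i).1.
  apply/card_le1_eqP => j j'; rewrite !inE !mxE => nzj nzj'.
  by apply: enum_val_inj; exact: ((Fsp i).2 _ _ (colsX j') (colsX j) nzj' nzj).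
- split=> //; rewrite powR_mulrn ?ler0n//.
  have kn : (2 ^ l <= n)%N.
    rewrite -(ler_nat R) (le_trans ly)// -[leRHS]powRr1 ?ler0n//.
    exact: ler_powR.
  rewrite -natrX ler_nat; apply: leq_trans mle _.
  apply: (@leq_trans ((2 ^ l) ^ ((A + 2) * d))%N).
    rewrite expnM leq_exp_base// -/N addnC expnD -/N.
    have N1 : (0 < N)%N by rewrite !expn_gt0.
    have k2 : (2 ^ 2 <= (2 ^ l) ^ 2)%N by rewrite leq_exp2r// -{1}[2%N]expn1 leq_exp2l.
    apply: leq_trans (leq_mul k2 (leqnn N)).
    exact: dbl.
  apply: (@leq_trans ((2 ^ l) ^ ((A + 2) * D))%N).
    by rewrite leq_pexp2l ?expn_gt0// leq_mul2l dD orbT.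
  by rewrite leq_exp_base.
- move=> j; exists (kap (enum_val j)).
    by move=> s; rewrite -ler_norml -abszE lez_nat kaple.
  rewrite add0r; apply/colP => i; rewrite !mxE summxE; apply: eq_bigr => s _.
  by rewrite -[gens s *~ _]scaler_int !mxE.
Qed.
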